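(* Let $\sigma>0$, $\bar\gamma>0$, $c_\infty\ge0$, and for $\gamma\in(0,\bar\gamma]$ let $\tau_\gamma:[0,\infty)\to[0,\infty)$ be non-decreasing with $\tau_\gamma(0)=0$, such that there exist $R_1,L\ge0$, $m>0$ with $\sup_{r>0}\tau_\gamma(r)/r\le1+\gamma L$ and $\sup_{r>R_1}\tau_\gamma(r)/r\le1-\gamma m$ for all $\gamma\in(0,\bar\gamma]$. Let $Q_\gamma$ be the Markov kernel on $[0,\infty)$ $$Q_\gamma(w,A)=\delta_0(A)\int_{\mathbb{R}}\bar p_{\sigma^2\gamma}(\tau_\gamma(w)+\gamma c_\infty,g)\varphi(g)dg+\int_{\mathbb{R}}\mathbb{1}_A(\tau_\gamma(w)+\gamma c_\infty-2\sigma\gamma^{1/2}g)\{1-\bar p_{\sigma^2\gamma}(\tau_\gamma(w)+\gamma c_\infty,g)\}\varphi(g)dg,$$ with $\bar p_{\sigma^2\gamma}(a,g)=1\wedge\varphi_{\sigma^2\gamma}(a-\sigma\sqrt\gamma g)/\varphi_{\sigma^2\gamma}(\sigma\sqrt\gamma g)$, and let $\mu_\gamma$ be its unique invariant probability measure. Let $\zeta=2(1+\bar\gamma L)^2\sigma^2(2\sqrt{2\pi})^{-1}[\sup_{t\ge0}\{t^2\Phi(-t)\}+1/8]$. Then for any $\bar\delta\in(0,\{L^{-1}\wedge(\sigma e^{-1}/c_\infty)^2\}]$ (with the convention $1/0=+\infty$) and any $\gamma\in(0,\bar\gamma]$, $$\int_{[0,\infty)}w\,\mu_\gamma(dw)\le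 c_\infty c_1,\qquad \mu_\gamma((0,+\infty))\le c_\infty c_2,$$ where $$\eta_1=[\bar\delta+\bar\gamma]^{1/2}\Big[\frac{2\zeta e^{3(\bar\delta+\bar\gamma)L}}{\sigma^3}+\frac{e^{(\bar\delta+\bar\gamma)L}}{2\sqrt{2\pi}\sigma}\Big]\Big/\Phi\Big(-\frac{(1+\bar\gamma L)R_1+(\bar\delta+\bar\gamma)c_\infty}{2\bar\delta^{1/2}\sigma e^{-(\bar\delta+\bar\gamma)L}}\Big),$$ $$c_1=\eta_1R_1(1+L/m)+1/m,\qquad c_2=e^{(\bar\delta+\bar\gamma)L}\big(c_1(1+\bar\gamma L)/\bar\delta^{1/2}+[\bar\delta+\bar\gamma]^{1/2}\big)/(\sqrt{2\pi}\sigma)+2\zeta[\bar\delta+\bar\gamma]^{1/2}e^{3(\bar\delta+\bar\gamma)L}/\sigma^3.$$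
   Context: $\varphi$ and $\Phi$ are the standard normal density and distribution function; $\varphi_s(t)=(2\pi s)^{-1/2}e^{-t^2/(2s)}$. *)

(* Defs.v *)
From HB Require Import structures.
From mathcomp Require Import all_boot all_order all_algebra.
From mathcomp Require Import all_classical all_reals all_analysis.
Set Implicit Arguments. Unset Strict Implicit. Unset Printing Implicit Defensive.
Import Order.TTheory GRing.Theory Num.Theory.
Import numFieldNormedType.Exports.
Local Open Scope classical_set_scope.
Local Open Scope ring_scope.

Section Defs.
Variable R : realType.

Definition phi (t : R) : R := expR (- (t ^+ 2) / 2) / Num.sqrt (2 * pi).

Definition phis (s t : R) : R := (Num.sqrt (2 * pi * s))^-1 * expR (- (t ^+ 2) / (2 * s)).

Definition Phi (t : R) : R :=
  fine (\int[@lebesgue_measure R]_(x in [set x : R | (x <= t)%R]) (phi x)%:E)%E.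

Definition pbar (s a g : R) : R :=
  Num.min 1 (phis s (a - Num.sqrt s * g) / phis s (Num.sqrt s * g)).

Definition Qker (sigma cinf gamma : R) (tg : R -> R) (w : R) (A : set R) : \bar R :=
  let a := tg w + gamma * cinf in
  ((@dirac _ R (0%R : R) R A) * \int[@lebesgue_measure R]_(g in setT)
       (pbar (sigma ^+ 2 * gamma) a g * phi g)%:E
   + \int[@lebesgue_measure R]_(g in setT)
       ((\1_A (a - 2 * sigma * Num.sqrt gamma * g) : R)
          * (1 - pbar (sigma ^+ 2 * gamma) a g) * phi g)%:E)%E.

Definition invariant_prob (sigma cinf gamma : R) (tg : R -> R)
    (mu : probability R R) : Prop :=
  mu [set x : R | (x < 0)%R] = 0%E /\
  forall A : set R, measurable A ->
    mu A = (\int[mu]_(w in [set w : R | (0 <= w)%R]) Qker sigma cinf gamma tg w A)%E.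

Definition zeta (sigma gbar L : R) : R :=
  2 * (1 + gbar * L) ^+ 2 * sigma ^+ 2 / (2 * Num.sqrt (2 * pi)) *
  (sup [set t ^+ 2 * Phi (- t) | t in [set t : R | 0 <= t]] + 1 / 8).

Definition eta1 (sigma gbar cinf R1 L dbar : R) : R :=
  Num.sqrt (dbar + gbar) *
  (2 * zeta sigma gbar L * expR (3 * (dbar + gbar) * L) / sigma ^+ 3
   + expR ((dbar + gbar) * L) / (2 * Num.sqrt (2 * pi) * sigma))
  / Phi (- (((1 + gbar * L) * R1 + (dbar + gbar) * cinf)
            / (2 * Num.sqrt dbar * sigma * expR (- ((dbar + gbar) * L))))).

Definition c1 (sigma gbar cinf R1 L m dbar : R) : R :=
  eta1 sigma gbar cinf R1 L dbar * R1 * (1 + L / m) + 1 / m.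

Definition c2 (sigma gbar cinf R1 L m dbar : R) : R :=
  expR ((dbar + gbar) * L) *
    (c1 sigma gbar cinf R1 L m dbar * (1 + gbar * L) / Num.sqrt dbar
     + Num.sqrt (dbar + gbar)) / (Num.sqrt (2 * pi) * sigma)
  + 2 * zeta sigma gbar L * Num.sqrt (dbar + gbar)
      * expR (3 * (dbar + gbar) * L) / sigma ^+ 3.

End Defs.

(* Main.v *)
Require Import Defs.
From HB Require Import structures.
From mathcomp Require Import all_boot all_order all_algebra.
From mathcomp Require Import all_classical all_reals all_analysis.
From mathcomp Require Import measurable_realfun ring lra.
Import Order.TTheory GRing.Theory Num.Theory.
Import numFieldNormedType.Exports.
Local Open Scope classical_set_scope.
Local Open Scope ring_scope.

(** A step of [Q_gamma] from [a = tau(w) + gamma c] kills exactly the mass that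
    the reflection principle cancels: for odd [f], the expectation of [f] at the
    new point is [E f(a + 2 s N)], with [s = sigma sqrt(gamma)] and [N] standard
    normal.  So the positive part of the new point has the density of a Gaussian
    minus its mirror image, and stationarity of [mu] can be tested on functions
    that are increasing and concave on the half-line.

    - Testing on [y] and on [min(y, N)] gives the stationary mean in terms of
      [c/m] and of [mu(0, R1]].
    - The functions [2 Phi(r y) - 1] are mapped to one another.  Iterating
      about [dbar/gamma] times from the indicator of the positive half-line, the
      drift [c] costs [c phi(0) sqrt(gamma) / (sigma sqrt k)] at the k-th step, and
      summing these bounds [mu(0, R1]] by [c eta1].
    - A bound on [mu(0, oo)] obtained by the same iteration would carry the
      constant [2] in front of [c sqrt(dbar) / (sqrt(2 pi) sigma)], which is too
      large.  Testing instead on the truncated cubic [A^3 - max(A - y, 0)^3], with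
      [A = sigma sqrt(2 pi dbar)], gives [pi/2], and
      [pi/2 <= 5/4 + 2 sup t^2 Phi(-t)], an inequality with a margin of about
      one percent (take [t = 6/5]). *)

(** * Affine changes of variable for Lebesgue integrals *)

Section AffineSubstitution.
Context {R : realType}.
Local Notation leb := (@lebesgue_measure R).

(** Uniqueness of Lebesgue measure: the rescaled push-forward along [x => q * x + b] agrees with it
    on half-open intervals. *)
Lemma lebesgue_measure_affine (q b : R) (A : set (measurableTypeR R)) :
  0 < q -> measurable A ->
  (q%:E * leb ((fun x => q * x + b)%R @^-1` A) = leb A)%E.
Proof.
move=> q0 mA; apply/esym.
pose f := (fun x : measurableTypeR R => q * x + b : measurableTypeR R).
have mf : measurable_fun setT f by apply: measurable_funD => //; exact: measurable_funM.
pose m : {measure set (measurableTypeR R) -> \bar R} :=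
  mscale (NngNum (ltW q0)) (pushforward leb f).
rewrite -[RHS]/(m mf A); apply: lebesgue_measure_unique => //= _ [[c d]] _ <-.
rewrite /m /mscale /= /pushforward.
have -> : f @^-1` `]c, d]%classic = `](c - b) / q, (d - b) / q]%classic.
  apply/seteqP; split=> x /=; rewrite !in_itv/= ltr_pdivrMr// ler_pdivlMr//;
    by rewrite ltrBlDr lerBrDr /f ![x * q]mulrC.
rewrite !lebesgue_measure_itv/= !lte_fin ltr_pM2r ?invr_gt0// ltrD2r.
case: ifPn => _; last by rewrite mule0.
rewrite -!EFinB -EFinM; congr (_%:E).
by field; rewrite gt_eqF.
Qed.

Lemma ge0_integral_affine (q b : R) (f : R -> \bar R) : 0 < q ->
  measurable_fun setT f -> (forall x, (0 <= f x)%E) ->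
  (\int[leb]_x f x = q%:E * \int[leb]_x f (q * x + b)%R)%E.
Proof.
move=> q0 mf f0.
pose g := (fun x : measurableTypeR R => q * x + b : measurableTypeR R).
have mg : measurable_fun setT g by apply: measurable_funD => //; exact: measurable_funM.
pose m : {measure set (measurableTypeR R) -> \bar R} := pushforward leb g.
have -> : (\int[leb]_x f (q * x + b)%R = \int[m mg]_x f x)%E.
  by rewrite ge0_integral_pushforward.
rewrite -(ge0_integral_mscale _ _ (NngNum (ltW q0)))//.
apply: eq_measure_integral => A mA _ /=.
by rewrite /mscale/= /pushforward/= -/(g) lebesgue_measure_affine.
Qed.

Lemma ge0_integral_opp (f : R -> \bar R) :
  measurable_fun setT f -> (forall x, (0 <= f x)%E) ->
  (\int[leb]_x f x = \int[leb]_x f (- x)%R)%E.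
Proof.
move=> mf f0.
pose g := (fun x : measurableTypeR R => - x : measurableTypeR R).
have mg : measurable_fun setT g by exact: oppr_measurable.
pose m : {measure set (measurableTypeR R) -> \bar R} := pushforward leb g.
have -> : (\int[leb]_x f (- x)%R = \int[m mg]_x f x)%E.
  by rewrite ge0_integral_pushforward.
apply: eq_measure_integral => A mA _ /=.
by rewrite -[LHS](lebesgue_measureN mA).
Qed.

Lemma ge0_integral_reflect (b : R) (f : R -> \bar R) :
  measurable_fun setT f -> (forall x, (0 <= f x)%E) ->
  (\int[leb]_x f x = \int[leb]_x f (b - x)%R)%E.
Proof.
move=> mf f0; rewrite (ge0_integral_affine 1 b)// mul1e ge0_integral_opp//.
- by apply: eq_integral => x _; rewrite mul1r addrC.
- apply: measurableT_comp => //; apply: measurable_funD => //.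
Qed.

End AffineSubstitution.

(** * The normal density, its distribution function and its half-line moments *)

Section Gaussian.
Context {R : realType}.
Local Notation leb := (@lebesgue_measure R).
Local Notation phi := (@phi R).
Local Notation Phi := (@Phi R).
Implicit Types a b r t x y : R.

Lemma sqrt2pi_gt0 : 0 < Num.sqrt (2 * pi) :> R.
Proof. by rewrite sqrtr_gt0 mulr_gt0// pi_gt0. Qed.

Lemma phi_gt0 t : 0 < phi t.
Proof. by rewrite divr_gt0 ?expR_gt0 ?sqrt2pi_gt0. Qed.

Lemma phi_ge0 t : 0 <= phi t. Proof. exact: ltW (phi_gt0 t). Qed.

Lemma phiN t : phi (- t) = phi t.
Proof. by rewrite /Defs.phi sqrrN. Qed.

Lemma phi0 : phi 0 = (Num.sqrt (2 * pi))^-1.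
Proof. by rewrite /Defs.phi expr0n oppr0 mul0r expR0 mul1r. Qed.

Lemma phi_le0 t : phi t <= phi 0.
Proof.
rewrite ler_pM2r ?invr_gt0 ?sqrt2pi_gt0// ler_expR expr0n oppr0 mul0r.
by rewrite mulr_le0_ge0// oppr_le0 sqr_ge0.
Qed.

Global Instance is_derive_phi t : is_derive t 1 phi (- t * phi t).
Proof.
have : is_derive t 1 (fun x => (Num.sqrt (2 * pi))^-1 *: expR (- (x ^+ 2) / 2))
    (- t * phi t).
  apply: is_derive_eq.
  by rewrite /Defs.phi /GRing.scale/=; field; rewrite gt_eqF// sqrt2pi_gt0.
by congr is_derive; apply/funext => x; rewrite /Defs.phi /GRing.scale/= mulrC.
Qed.

Lemma derivable_phi t : derivable phi t 1.
Proof. exact: ex_derive. Qed.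

Lemma continuous_phi : continuous phi.
Proof.
by move=> t; apply/differentiable_continuous/derivable1_diffP/derivable_phi.
Qed.

Lemma measurable_phi : measurable_fun setT phi.
Proof. exact: continuous_measurable_fun continuous_phi. Qed.

Lemma phi_normal_pdf : phi = normal_pdf 0 1.
Proof.
apply/funext => t; rewrite normal_pdfE ?oner_eq0//.
rewrite /Defs.phi /normal_peak /normal_fun expr1n mul1r subr0 mulrC.
by rewrite (mulr_natl pi 2).
Qed.

Lemma integral_phi : (\int[leb]_x (phi x)%:E = 1)%E.
Proof. by rewrite phi_normal_pdf integral_normal_pdf. Qed.

Lemma integrable_phi : leb.-integrable setT (EFin \o phi).
Proof. by rewrite phi_normal_pdf; exact: integrable_normal_pdf. Qed.

(** From [1 + u ^+ 2 / 2 <= expR u] at [u = r ^+ 2 / 2]; a decay of order $r^{-4}$ for [phi] is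
    enough to beat quadratic prefactors. *)
Lemma phi_tail_sq r : 0 < r -> r ^+ 2 * phi r <= 8 * phi 0 / r ^+ 2.
Proof.
move=> r0; have r20 : 0 < r ^+ 2 by rewrite exprn_gt0.
have e : 1 + (r ^+ 2 / 2) ^+ 2 / 2 <= expR (r ^+ 2 / 2).
  by have := @expR_ge1Dxn _ (r ^+ 2 / 2) 1; apply; rewrite divr_ge0// ltW.
rewrite ler_pdivlMr// /Defs.phi expr0n/= oppr0 mul0r expR0.
rewrite mulrAC mulrA mulrA ler_pM2r ?invr_gt0 ?sqrt2pi_gt0// mulr1.
rewrite mulNr expRN ler_pdivrMr ?expR_gt0//.
nra.
Qed.

(** Degree two suffices: these are the boundary terms at infinity of the antiderivatives for moments
    up to order three. *)
Lemma cvg_poly_phi (c0 c1 c2 b : R) :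
  (c0 + c1 * (t - b) + c2 * (t - b) ^+ 2) * phi (t - b) @[t --> +oo] --> (0 : R).
Proof.
pose C := (`|c0| + `|c1| + `|c2|) * (8 * phi 0).
have C0 : 0 <= C by rewrite mulr_ge0 ?addr_ge0// mulr_ge0// phi_ge0.
apply/cvgrPdist_le => e e0; near=> t.
have r1 : 1 <= t - b by rewrite lerBrDr; near: t; apply: nbhs_pinfty_ge; rewrite num_real.
have rC : C / e <= t - b by rewrite lerBrDr; near: t; apply: nbhs_pinfty_ge; rewrite num_real.
move: (t - b) r1 rC => r r1 rC; rewrite sub0r normrN normrM (ger0_norm (phi_ge0 _)).
have r0 : 0 < r by exact: lt_le_trans r1.
have rr : r <= r ^+ 2 by rewrite expr2 ler_pMr.
have r21 : 1 <= r ^+ 2 by exact: le_trans rr.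
apply: (@le_trans _ _ ((`|c0| + `|c1| + `|c2|) * (r ^+ 2 * phi r))).
  rewrite [leRHS]mulrA ler_wpM2r ?phi_ge0//.
  apply: (le_trans (ler_normD _ _)); rewrite [leRHS]mulrDl lerD//; last first.
    by rewrite normrM (ger0_norm (sqr_ge0 _)).
  apply: (le_trans (ler_normD _ _)); rewrite [leRHS]mulrDl lerD//.
    by rewrite ler_peMr.
  by rewrite normrM (gtr0_norm r0) ler_wpM2l.
apply: (@le_trans _ _ (C / r ^+ 2)).
  by rewrite /C -[leRHS]mulrA ler_wpM2l ?addr_ge0// phi_tail_sq.
rewrite ler_pdivrMr ?exprn_gt0//; move: rC; rewrite ler_pdivrMr// mulrC => rC.
by apply: (le_trans rC); rewrite ler_pM2l.
Unshelve. all: end_near. Qed.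

Lemma integrable_phiS (D : set R) : measurable D -> leb.-integrable D (EFin \o phi).
Proof. by move=> mD; apply: integrableS integrable_phi. Qed.

Lemma PhiE t : (Phi t)%:E = (\int[leb]_(x in `]-oo, t]) (phi x)%:E)%E.
Proof.
rewrite /Defs.Phi fineK; last first.
  have m : measurable [set x | x <= t] by rewrite -set_itvNyc; exact: measurable_itv.
  exact: integrable_fin_num (integrable_phiS _ m).
by rewrite set_itvNyc.
Qed.

Lemma PhiRE t : Phi t = \int[leb]_(x in `]-oo, t]) (phi x).
Proof. by rewrite /Rintegral -PhiE. Qed.

Global Instance is_derive_Phi t : is_derive t 1 Phi (phi t).
Proof.
have -> : Phi = (fun t => \int[leb]_(x in `]-oo, t]) (phi x)).
  by apply/funext => x; exact: PhiRE.
have [] := @continuous_FTC1 _ phi -oo%O t (t + 1) _ _ _ _.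
- by rewrite ltrDl.
- exact: integrable_phiS.
- by rewrite ltNyr.
- exact: continuous_phi.
by move=> d <-; rewrite derive1E; exact: DeriveDef.
Qed.

Lemma continuous_Phi : continuous Phi.
Proof.
by move=> t; apply/differentiable_continuous/derivable1_diffP; exact: ex_derive.
Qed.

Lemma measurable_Phi : measurable_fun setT Phi.
Proof. exact: continuous_measurable_fun continuous_Phi. Qed.

Lemma Phi_ge0 t : 0 <= Phi t.
Proof.
by rewrite -lee_fin PhiE; apply: integral_ge0 => x _; rewrite lee_fin phi_ge0.
Qed.

Lemma integral_phi_shift b : (\int[leb]_(t in `[0%R, +oo[) (phi (t - b))%:E = (Phi b)%:E)%E.
Proof.
rewrite PhiE integral_mkcond [in RHS]integral_mkcond/=.
rewrite [RHS](ge0_integral_reflect b).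
- apply: eq_integral => x _; rewrite /patch/=.
  rewrite !mem_setE !in_itv/= andbT lerBlDr lerDl.
  by case: ifP => // _; rewrite -opprB phiN.
- apply/(measurable_restrictT _ _).1 => //; apply: measurable_funTS.
  by apply/measurable_EFinP; exact: measurable_phi.
- by move=> x; rewrite /patch; case: ifP => // _; rewrite lee_fin phi_ge0.
Qed.

Lemma integral_phi_ge t : (\int[leb]_(x in `[t, +oo[) (phi x)%:E = (Phi (- t))%:E)%E.
Proof.
rewrite PhiE integral_mkcond [in RHS]integral_mkcond/= [RHS]ge0_integral_opp.
- apply: eq_integral => x _; rewrite /patch/=.
  by rewrite !mem_setE !in_itv/= andbT lerN2; case: ifP => // _; rewrite phiN.
- apply/(measurable_restrictT _ _).1 => //; apply: measurable_funTS.
  by apply/measurable_EFinP; exact: measurable_phi.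
- by move=> x; rewrite /patch; case: ifP => // _; rewrite lee_fin phi_ge0.
Qed.

Lemma PhiN t : Phi (- t) = 1 - Phi t.
Proof.
apply/EFin_inj; rewrite EFinB -integral_phi -(setUv `]-oo, t]%classic).
have mphi (D : set R) : measurable_fun D (EFin \o phi).
  by apply: measurable_funTS; apply/measurable_EFinP; exact: measurable_phi.
rewrite ge0_integral_setU//=; first last.
- by rewrite disj_set2E setICr.
- by move=> x _; rewrite lee_fin phi_ge0.
- exact: mphi.
- by apply: measurableC; exact: measurable_itv.
rewrite -PhiE (@setCitvl _ _ (BRight t)) integral_itv_obnd_cbnd ?integral_phi_ge//.
by congr EFin; rewrite addrAC subrr add0r.
Qed.

Lemma Phi0 : Phi 0 = 2^-1.
Proof. by have := PhiN 0; rewrite oppr0 => h; lra. Qed.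

(** Common device for the one-variable inequalities below, with the derivative given explicitly. *)
Lemma is_derive_ge0_ndecr (f f' : R -> R) a x y :
  (forall z : R, is_derive z 1 f (f' z)) -> (forall z, a <= z -> 0 <= f' z) ->
  a <= x -> x <= y -> f x <= f y.
Proof.
move=> df f'0; apply: ger0_derive1_ndecry => [z _|z|].
- by have dz := df z; exact: ex_derive.
- rewrite in_itv/= andbT => /ltW /f'0 h; have dz := df z.
  by rewrite derive1E derive_val.
- apply: continuous_subspaceT => z; have dz := df z.
  by apply/differentiable_continuous/derivable1_diffP; exact: ex_derive.
Qed.

Lemma Phi_nd x y : x <= y -> Phi x <= Phi y.
Proof.
move=> xy; apply: (@is_derive_ge0_ndecr _ phi x) => // z _; exact: phi_ge0.
Qed.

Lemma Phi_lipschitz x y : x <= y -> Phi y <= Phi x + (y - x) * phi 0.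
Proof.
move=> xy; pose f z := z * phi 0 - Phi z.
have df (z : R) : is_derive z 1 f (phi 0 - phi z).
  by apply: is_derive_eq; rewrite /GRing.scale/=; ring.
suff : f x <= f y by rewrite /f; lra.
by apply: (@is_derive_ge0_ndecr f _ x x y df) => // z _; rewrite subr_ge0 phi_le0.
Qed.

Lemma Phi_le1 t : Phi t <= 1.
Proof. by have := Phi_ge0 (- t); rewrite PhiN; lra. Qed.

Lemma Phi_ge_half t : 0 <= t -> 2^-1 <= Phi t.
Proof. by move=> t0; rewrite -Phi0 Phi_nd. Qed.

Lemma is_derive_shift (f : R -> R) (d b t : R) :
  is_derive (t - b) 1 f d -> is_derive t 1 (fun t => f (t - b)) d.
Proof.
move=> df; have dg : is_derive t 1 (fun t : R => t - b) 1.
  by apply: is_derive_eq; rewrite subr0.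
by have := @is_derive1_comp _ f (fun t => t - b) t d 1 df dg; rewrite mulr1.
Qed.

(** On [[t, +oo[] with [1 <= t] the density is at most [x * phi x], whose antiderivative is
    [- phi x]. *)
Lemma Phi_tail t : 1 <= t -> 1 - phi t <= Phi t.
Proof.
move=> t1; suff : Phi (- t) <= phi t by rewrite PhiN; lra.
rewrite -lee_fin -integral_phi_ge.
have -> : (phi t)%:E = (\int[leb]_(x in `[t, +oo[) (x * phi x)%:E)%E.
  rewrite (@ge0_continuous_FTC2y _ _ (fun x => - phi x) _ 0).
  - by rewrite sub0e -EFinN opprK.
  - move=> x tx; rewrite mulr_ge0 ?phi_ge0//; lra.
  - apply: continuous_subspaceT => x; apply: cvgM => //; exact: continuous_phi.
  - rewrite -oppr0; apply: cvgN.
    have := @cvg_poly_phi 1 0 0 0; apply: cvg_trans; apply: near_eq_cvg.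
    by near=> x; rewrite subr0 !mul0r !addr0 mul1r.
  - by move=> x _; exact: ex_derive.
  - apply: cvgN; apply: cvg_at_right_filter; exact: continuous_phi.
  - move=> x _; rewrite derive1E.
    have d : is_derive x 1 (fun x => - phi x) (x * phi x).
      by apply: is_derive_eq; ring.
    by rewrite derive_val.
apply: ge0_le_integral => //=.
- by move=> x _; rewrite lee_fin phi_ge0.
- by apply: measurable_funTS; apply/measurable_EFinP; exact: measurable_phi.
- apply: measurable_funTS; apply/measurable_EFinP.
  apply: measurable_funM => //; exact: measurable_phi.
- move=> x; rewrite in_itv/= andbT => tx.
  by rewrite lee_fin ler_peMl ?phi_ge0//; lra.
Unshelve. all: end_near. Qed.

Lemma cvg_Phi_shift b : Phi (t - b) @[t --> +oo] --> (1 : R).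
Proof.
apply: (@squeeze_cvgr _ _ _ _ (fun t => 1 - phi (t - b)) (fun=> 1)).
- near=> t; rewrite Phi_le1 andbT Phi_tail// lerBrDr.
  by near: t; apply: nbhs_pinfty_ge; rewrite num_real.
- rewrite -[X in _ --> X]subr0; apply: cvgB; first exact: cvg_cst.
  have := @cvg_poly_phi 1 0 0 b; apply: cvg_trans; apply: near_eq_cvg.
  by near=> x; rewrite !mul0r !addr0 mul1r.
- exact: cvg_cst.
Unshelve. all: end_near. Qed.

(** The antiderivative is [k * Phi] minus a quadratic times [phi], both at [t - b]. Matching powers
    of [t - b] in $t^n$ gives the coefficients for the three moments that follow. *)
Lemma integral_gaussian_antiderivative (c0 c1 c2 k b : R) (f : R -> R) :
  (forall t, 0 <= t -> 0 <= f t) ->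
  (forall t, f t = (- (c1 + 2 * c2 * (t - b)) +
     (c0 + c1 * (t - b) + c2 * (t - b) ^+ 2) * (t - b) + k) * phi (t - b)) ->
  (\int[leb]_(t in `[0%R, +oo[) (f t)%:E =
    (k * Phi b + (c0 - c1 * b + c2 * b ^+ 2) * phi b)%:E)%E.
Proof.
move=> f0 fE.
pose F0 := fun r : R => k * Phi r - (c0 + c1 * r + c2 * r ^+ 2) * phi r.
pose F := fun t => F0 (t - b).
have dF t : is_derive t 1 F (f t).
  apply: is_derive_shift; rewrite fE.
  apply: is_derive_eq; rewrite /GRing.scale/=; ring.
have cF : continuous F.
  move=> t; have d := dF t.
  by apply/differentiable_continuous/derivable1_diffP; exact: ex_derive.
rewrite (@ge0_continuous_FTC2y _ f F 0 k)//.
- rewrite -EFinB; congr EFin; rewrite /F /F0 sub0r phiN PhiN; ring.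
- apply: continuous_subspaceT => t.
  pose h (r : R) := (- (c1 + 2 * c2 * r) + (c0 + c1 * r + c2 * r ^+ 2) * r + k) * phi r.
  have dh : derivable h (t - b) 1 by exact: ex_derive.
  have -> : f = (fun t => h (t - b)) by apply/funext.
  have /derivableP d := dh; have d' := is_derive_shift _ _ _ _ d.
  by apply/differentiable_continuous/derivable1_diffP; exact: ex_derive.
- rewrite -[X in _ --> X](_ : k * 1 - 0 = _); last by ring.
  apply: cvgB; last exact: cvg_poly_phi.
  by apply: cvgM; [exact: cvg_cst|exact: cvg_Phi_shift].
- by apply: cvg_at_right_filter; exact: cF.
- by move=> t _; have d := dF t; rewrite derive1E derive_val.
Qed.

Lemma gaussian_moment1 b :
  (\int[leb]_(t in `[0%R, +oo[) (t * phi (t - b))%:E = (b * Phi b + phi b)%:E)%E.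
Proof.
rewrite (@integral_gaussian_antiderivative 1 0 0 b b).
- by congr EFin; ring.
- by move=> t t0; rewrite mulr_ge0 ?phi_ge0.
- by move=> t; ring.
Qed.

Lemma gaussian_moment2 b :
  (\int[leb]_(t in `[0%R, +oo[) (t ^+ 2 * phi (t - b))%:E =
   ((1 + b ^+ 2) * Phi b + b * phi b)%:E)%E.
Proof.
rewrite (@integral_gaussian_antiderivative (2 * b) 1 0 (1 + b ^+ 2) b).
- by congr EFin; ring.
- by move=> t t0; rewrite mulr_ge0 ?phi_ge0// sqr_ge0.
- by move=> t; ring.
Qed.

Lemma gaussian_moment3 b :
  (\int[leb]_(t in `[0%R, +oo[) (t ^+ 3 * phi (t - b))%:E =
   ((b ^+ 3 + 3 * b) * Phi b + (b ^+ 2 + 2) * phi b)%:E)%E.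
Proof.
rewrite (@integral_gaussian_antiderivative (3 * b ^+ 2 + 2) (3 * b) 1 (b ^+ 3 + 3 * b) b).
- by congr EFin; ring.
- by move=> t t0; rewrite mulr_ge0 ?phi_ge0// exprn_ge0.
- by move=> t; ring.
Qed.

(** The difference of the two sides is the half-line first moment of a Gaussian centred at [- b]. *)
Lemma mills_ge0 b : b * Phi (- b) <= phi b.
Proof.
suff : (0%:E <= (- b * Phi (- b) + phi (- b))%:E)%E.
  by rewrite lee_fin phiN; lra.
rewrite -gaussian_moment1; apply: integral_ge0 => t /=.
by rewrite in_itv/= andbT => t0; rewrite lee_fin mulr_ge0 ?phi_ge0.
Qed.

End Gaussian.

(** * Gaussian averages of the functions [Phi (r * t)] *)

Section GaussianConvolution.
Context {R : realType}.
Local Notation leb := (@lebesgue_measure R).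
Local Notation phi := (@phi R).
Local Notation Phi := (@Phi R).
Implicit Types b r t x y : R.

Lemma integral_phi_affine (q c : R) : 0 < q ->
  (\int[leb]_x (phi (q * x + c))%:E = (q^-1)%:E)%E.
Proof.
move=> q0; have mphi : measurable_fun setT (EFin \o phi).
  by apply/measurable_EFinP; exact: measurable_phi.
have := ge0_integral_affine q c (EFin \o phi) q0 mphi.
rewrite /= integral_phi => /(_ (fun x => phi_ge0 x)) e.
have : ((q^-1)%R%:E * 1 = (q^-1)%R%:E * (q%:E * \int[leb]_x (phi (q * x + c))%:E))%E by rewrite -e.
by rewrite mule1 muleA -EFinM mulVf ?gt_eqF// mul1e => <-.
Qed.

(** Completing the square in [t]: the first factor on the right has total mass [q^-1] in [t], and
    the second does not involve [t]. *)
Lemma phi_mul_complete_square (r x t b : R) :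
  let q := Num.sqrt (1 + r ^+ 2) in
  phi (x + r * t) * phi (t - b) =
  phi (q * t + (r * x - b) / q) * phi (q^-1 * x + r * b / q).
Proof.
move=> q; have q2 : q ^+ 2 = 1 + r ^+ 2 by rewrite sqr_sqrtr// addr_ge0// sqr_ge0.
have q0 : q != 0 by rewrite gt_eqF// sqrtr_gt0 ltr_pwDl// sqr_ge0.
rewrite /Defs.phi mulrACA [RHS]mulrACA -!expRD; congr (expR _ * _).
suff : (x + r * t) ^+ 2 + (t - b) ^+ 2 =
  (q * t + (r * x - b) / q) ^+ 2 + (q^-1 * x + r * b / q) ^+ 2.
  by move=> h; lra.
have -> : (q * t + (r * x - b) / q) ^+ 2 + (q^-1 * x + r * b / q) ^+ 2 =
  q ^+ 2 * t ^+ 2 + 2 * t * (r * x - b) + (x ^+ 2 + b ^+ 2) * (1 + r ^+ 2) / q ^+ 2.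
  by field.
rewrite -q2 mulfK ?expf_neq0// q2; ring.
Qed.

(** For independent $X\sim N(0,1)$ and $T\sim N(b,1)$ the integral is $P(X-rT\le0)$, and $X-rT$ is
    normal with mean $-rb$ and variance $1+r^2$. *)
Lemma integral_Phi_phi (r b : R) : 
  (\int[leb]_t (Phi (r * t) * phi (t - b))%:E =
   (Phi (r * b / Num.sqrt (1 + r ^+ 2)))%:E)%E.
Proof.
set q := Num.sqrt (1 + r ^+ 2).
have q0 : 0 < q by rewrite sqrtr_gt0 ltr_pwDl// sqr_ge0.
have mphi : measurable_fun setT (EFin \o phi).
  by apply/measurable_EFinP; exact: measurable_phi.
have i0 x : 0 <= \1_(`]-oo, 0%R]%classic : set R) x :> R by rewrite indicE.
pose f (z : measurableTypeR R * measurableTypeR R) : \bar R :=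
  (\1_(`]-oo, 0%R]%classic : set R) z.2 * (phi (z.2 + r * z.1) * phi (z.1 - b)))%R%:E.
have mf : measurable_fun setT f.
  apply/measurable_EFinP; apply: measurable_funM.
    by apply: measurableT_comp => //; exact: measurable_indic.
  apply: measurable_funM; apply: (measurableT_comp measurable_phi).
    by apply: measurable_funD => //; exact: measurable_funM.
  exact: measurable_funB.
have f0 z : (0 <= f z)%E by rewrite lee_fin !mulr_ge0 ?phi_ge0.
have PhiI y : (Phi y)%:E = (\int[leb]_x (\1_(`]-oo, y]%classic : set R) x * phi x)%:E)%E.
  rewrite PhiE integral_mkcond; apply: eq_integral => x _.
  by rewrite /patch indicE; case: ifP; rewrite ?mul1r ?mul0r.
have mI y : measurable_fun setT (fun x : R => (\1_(`]-oo, y]%classic : set R) x * phi x)%:E).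
  apply/measurable_EFinP; apply: measurable_funM (measurable_phi).
  exact: measurable_indic.
have := fubini_tonelli f mf f0 => /=; rewrite /fubini_F /fubini_G /f/= => e.
(* Shifting [x] by [r * t] makes the inner domain independent of [t], so that the integrals can be
   exchanged. *)
transitivity (\int[leb]_t \int[leb]_x
    (\1_(`]-oo, 0%R]%classic : set R) x * (phi (x + r * t) * phi (t - b)))%:E)%E.
  apply: eq_integral => t _; rewrite EFinM PhiI muleC.
  rewrite (ge0_integral_affine 1 (r * t))//; last first.
    by move=> x; rewrite lee_fin mulr_ge0 ?phi_ge0.
  rewrite mul1e -ge0_integralZl//; first last.
  - by rewrite lee_fin phi_ge0.
  - by move=> x _; rewrite lee_fin mulr_ge0 ?phi_ge0.
  - apply: (measurableT_comp (mI _)); exact: measurable_funD.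
  apply: eq_integral => x _; rewrite -EFinM; congr EFin.
  rewrite mul1r !indicE !mem_setE !in_itv/= -[X in _ <= X]add0r lerD2r; ring.
(* After the exchange, rescaling the right-hand side by [q^-1] gives both sides the same outer
   variable; the inner integral then yields exactly the factor [q^-1]. *)
rewrite e PhiI (ge0_integral_affine q^-1 (r * b / q)) ?invr_gt0//; last first.
  by move=> x; rewrite lee_fin mulr_ge0 ?phi_ge0.
rewrite -ge0_integralZl//; first last.
- by rewrite lee_fin invr_ge0 ltW.
- by move=> x _; rewrite lee_fin mulr_ge0 ?phi_ge0.
- apply: (measurableT_comp (mI _)); exact: measurable_funD.
apply: eq_integral => x _.
under eq_integral do rewrite phi_mul_complete_square -/q mulrA mulrAC EFinM.
rewrite ge0_integralZl//; first last.
- by rewrite lee_fin mulr_ge0 ?phi_ge0.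
- by move=> t _; rewrite lee_fin phi_ge0.
- apply: (measurableT_comp mphi); exact: measurable_funD.
rewrite integral_phi_affine// -EFinM; congr EFin.
rewrite !indicE !mem_setE !in_itv/= -[q^-1 * x + _ <= _]subr_le0.
by rewrite addrK pmulr_rle0 ?invr_gt0//; ring.
Qed.

Lemma measurable_phiB (b : R) : measurable_fun setT (fun t => phi (t - b)).
Proof. by apply: (measurableT_comp measurable_phi); exact: measurable_funB. Qed.

Lemma measurable_PhiM (r : R) : measurable_fun setT (fun t => Phi (r * t)).
Proof. by apply: (measurableT_comp measurable_Phi); exact: measurable_funM. Qed.

(** [2 * Phi (r * t) - 1] is odd in [t], so integrating it over the half-line against a Gaussian
    minus its mirror image is integrating it over the whole line against the Gaussian. *)
Lemma sticky_Phi (r b : R) : 0 <= r -> 0 <= b ->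
  (\int[leb]_(t in `[0%R, +oo[)
     ((2 * Phi (r * t) - 1) * (phi (t - b) - phi (t + b)))%:E =
   (2 * Phi (r * b / Num.sqrt (1 + r ^+ 2)) - 1)%:E)%E.
Proof.
move=> r0 b0; set c := r * b / _; set X := (X in X = _).
pose D : set R := `[0%R, +oo[%classic.
have K0 t : D t -> 0 <= phi (t - b) - phi (t + b).
  rewrite /D/= in_itv/= andbT => t0; rewrite subr_ge0 ler_pM2r ?invr_gt0 ?sqrt2pi_gt0//.
  rewrite ler_expR; nra.
have P0 t : D t -> 0 <= 2 * Phi (r * t) - 1.
  rewrite /D/= in_itv/= andbT => t0.
  by have := @Phi_ge_half _ (r * t) (mulr_ge0 r0 t0); lra.
have mm := measurable_phiB b; have mp := measurable_phiB (- b).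
have mP := measurable_PhiM r; have mN := measurable_PhiM (- r).
have mD : measurable D by exact: measurable_itv.
(* The whole-line average, folded at [0]. *)
have e1 : ((Phi c)%:E = \int[leb]_(t in D) (Phi (r * t) * phi (t - b) +
    Phi (- r * t) * phi (t - - b))%:E)%E.
  rewrite /c -integral_Phi_phi -(setUv D) ge0_integral_setU//=; first last.
  - by rewrite disj_set2E setICr.
  - by move=> t _; rewrite lee_fin mulr_ge0 ?Phi_ge0 ?phi_ge0.
  - by apply: measurable_funTS; apply/measurable_EFinP; exact: measurable_funM.
  - exact: measurableC.
  under [in RHS]eq_integral do rewrite EFinD.
  rewrite ge0_integralD//=; first last.
  - by apply: measurable_funTS; apply/measurable_EFinP; exact: measurable_funM.
  - by move=> t _; rewrite lee_fin mulr_ge0 ?Phi_ge0 ?phi_ge0.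
  - by apply: measurable_funTS; apply/measurable_EFinP; exact: measurable_funM.
  - by move=> t _; rewrite lee_fin mulr_ge0 ?Phi_ge0 ?phi_ge0.
  congr (_ + _)%E.
  rewrite /D (@setCitvr _ _ (BLeft 0)) integral_itv_bndo_bndc//; last first.
    by apply: measurable_funTS; apply/measurable_EFinP; exact: measurable_funM.
  rewrite integral_mkcond [in RHS]integral_mkcond/= ge0_integral_opp.
  - apply: eq_integral => t _; rewrite /patch !mem_setE !in_itv/= andbT oppr_le0.
    by case: ifP => // _; rewrite mulrN -mulNr opprK -[- t - b]opprD phiN.
  - apply/(measurable_restrictT _ _).1 => //; apply: measurable_funTS.
    by apply/measurable_EFinP; exact: measurable_funM.
  - move=> t; rewrite /patch; case: ifP => // _.
    by rewrite lee_fin mulr_ge0 ?Phi_ge0 ?phi_ge0.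
(* Adding [1 = Phi b + Phi (- b)], the half-line mass of the two Gaussians, leaves only integrals of
   nonnegative functions to combine. *)
have : (X + 1 = 2%:E * (Phi c)%:E)%E.
  rewrite e1 -ge0_integralZl//=; first last.
  - by move=> t _; rewrite lee_fin addr_ge0 ?mulr_ge0 ?Phi_ge0 ?phi_ge0.
  - apply: measurable_funTS; apply/measurable_EFinP.
    by apply: measurable_funD; exact: measurable_funM.
  transitivity (X + \int[leb]_(t in D) ((phi (t - b))%:E + (phi (t - - b))%:E))%E.
    rewrite ge0_integralD//=; first last.
    - by apply: measurable_funTS; apply/measurable_EFinP.
    - by move=> t _; rewrite lee_fin phi_ge0.
    - by apply: measurable_funTS; apply/measurable_EFinP.
    - by move=> t _; rewrite lee_fin phi_ge0.
    by rewrite !integral_phi_shift PhiN -EFinD; congr (_ + _%:E)%E; ring.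
  rewrite /X -ge0_integralD//=; first last.
  - apply: measurable_funTS; apply: emeasurable_funD; exact/measurable_EFinP.
  - by move=> t _; rewrite -EFinD lee_fin addr_ge0// phi_ge0.
  - apply: measurable_funTS; apply/measurable_EFinP; apply: measurable_funM.
      by apply: measurable_funB => //; exact: measurable_funM.
    apply: measurable_funB => //; move: mp; by under eq_fun do rewrite opprK.
  - by move=> t Dt; rewrite lee_fin mulr_ge0 ?K0 ?P0.
  apply: eq_integral => t _; rewrite -!EFinD -EFinM; congr EFin.
  rewrite opprK mulNr PhiN; ring.
by move=> h; rewrite -[LHS](@addeK _ 1%:E X)// h.
Qed.

End GaussianConvolution.

(** * The numerical inequality between [pi] and the supremum of $t^2\Phi(-t)$ *)

Section NumericalBounds.
Context {R : realType}.
Local Notation phi := (@phi R).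
Local Notation Phi := (@Phi R).
Implicit Types t x y : R.

Lemma sin_le x : 0 <= x -> sin x <= x.
Proof.
move=> x0; pose f (y : R) := y - sin y.
have df (z : R) : is_derive z 1 f (1 - cos z) by apply: is_derive_eq.
have := @is_derive_ge0_ndecr _ f _ 0 0 x df _ (lexx _) x0.
rewrite /f sin0 subrr subr_ge0; apply => z _; by rewrite subr_ge0 cos_le1.
Qed.

Lemma cos_ge_taylor2 x : 0 <= x -> 1 - x ^+ 2 / 2 <= cos x.
Proof.
move=> x0; pose f (y : R) := cos y + y ^+ 2 / 2.
have df (z : R) : is_derive z 1 f (z - sin z).
  by apply: is_derive_eq; rewrite /GRing.scale/=; field.
have := @is_derive_ge0_ndecr _ f _ 0 0 x df _ (lexx _) x0.
rewrite /f cos0 expr0n/= mul0r addr0 => h; rewrite lerBlDr; apply: h => z z0.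
by rewrite subr_ge0 sin_le.
Qed.

Lemma sin_ge_taylor3 x : 0 <= x -> x - x ^+ 3 / 6 <= sin x.
Proof.
move=> x0; pose f (y : R) := sin y + y ^+ 3 / 6 - y.
have df (z : R) : is_derive z 1 f (cos z + z ^+ 2 / 2 - 1).
  by apply: is_derive_eq; rewrite /GRing.scale/=; field.
have := @is_derive_ge0_ndecr _ f _ 0 0 x df _ (lexx _) x0.
rewrite /f sin0 expr0n/= mul0r addr0 subr0 => h.
have h' : 0 <= sin x + x ^+ 3 / 6 - x.
  apply: h => z z0; have := @cos_ge_taylor2 z z0; lra.
lra.
Qed.

Lemma cos_sin_piquarter :
  cos (pi / 4) ^+ 2 = 2^-1 :> R /\ sin (pi / 4) ^+ 2 = 2^-1 :> R.
Proof.
have h1 := cos2Dsin2 (pi / 4 : R).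
have h2 := cos_pihalf R.
have e : pi / 2 = (pi / 4) *+ 2 :> R by rewrite mulr2n; field.
rewrite e cos_mulr2n in h2; lra.
Qed.

(** If [pi < 3], the quadratic Taylor bound makes [cos (pi / 4)] at least 0.71, whose square exceeds
    one half. *)
Lemma pi_ge3 : 3 <= pi :> R.
Proof.
rewrite leNgt; apply/negP => p3; have p2 := @pi_ge2 R.
have [c2 _] := cos_sin_piquarter.
have p0 : 0 <= pi / 4 :> R by rewrite divr_ge0// pi_ge0.
have := cos_ge_taylor2 _ p0; move: (cos _) c2 => c c2 h.
have : (pi / 4) ^+ 2 <= (3 / 4) ^+ 2 :> R by rewrite ler_pXn2r ?nnegrE//; lra.
move=> hp; have c0 : 71 / 100 <= c by lra.
have : (71 / 100) ^+ 2 <= c ^+ 2 by rewrite ler_pXn2r ?nnegrE//; lra.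
lra.
Qed.

(** If [pi] exceeded 3.16, then [sin (pi / 4)] would exceed [sin 0.79], and the cubic Taylor bound
    puts the square of the latter above one half. *)
Lemma pi_le316 : pi <= 316 / 100 :> R.
Proof.
rewrite leNgt; apply/negP => p3; have p4 := @pihalf_lt2 R.
have [_ s2] := cos_sin_piquarter.
have s : sin (79 / 100) < sin (pi / 4) :> R.
  by rewrite ltr_sin ?in_itv/=; [lra|apply/andP; split; lra..].
have := @sin_ge_taylor3 (79 / 100) => /(_ ltac:(lra)); nra.
Qed.

(** Each Taylor remainder, with its sign, vanishes at [0] and has the previous one as derivative. *)
Lemma expRN_le_taylor4 (u : R) : 0 <= u ->
  expR (- u) <= 1 - u + u ^+ 2 / 2 - u ^+ 3 / 6 + u ^+ 4 / 24.
Proof.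
have e0 (v : R) : 0 <= v -> 0 <= 1 - expR (- v).
  by move=> v0; rewrite subr_ge0 -[leRHS](@expR0 R) ler_expR oppr_le0.
have step (f f' : R -> R) : (forall z : R, is_derive z 1 f (f' z)) -> f 0 = 0 ->
    (forall z : R, 0 <= z -> 0 <= f' z) -> forall z : R, 0 <= z -> 0 <= f z.
  by move=> df f0 h z z0; rewrite -f0; exact: (@is_derive_ge0_ndecr _ f f' 0).
have e1 := step (fun u : R => expR (- u) - (1 - u)) (fun u : R => 1 - expR (- u)).
have e2 := step (fun u : R => (1 - u + u ^+ 2 / 2) - expR (- u)) (fun u : R => expR (- u) - (1 - u)).
have e3 := step (fun u : R => expR (- u) - (1 - u + u ^+ 2 / 2 - u ^+ 3 / 6))
   (fun u : R => (1 - u + u ^+ 2 / 2) - expR (- u)).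
have e4 := step (fun u : R => (1 - u + u ^+ 2 / 2 - u ^+ 3 / 6 + u ^+ 4 / 24) - expR (- u))
   (fun u : R => expR (- u) - (1 - u + u ^+ 2 / 2 - u ^+ 3 / 6)).
move=> u0; rewrite -subr_ge0; apply: e4 => //.
- by move=> z; apply: is_derive_eq; rewrite /GRing.scale/=; field.
- by rewrite oppr0 expR0 !expr0n/=; lra.
apply: e3.
- by move=> z; apply: is_derive_eq; rewrite /GRing.scale/=; field.
- by rewrite oppr0 expR0 !expr0n/=; lra.
apply: e2.
- by move=> z; apply: is_derive_eq; rewrite /GRing.scale/=; field.
- by rewrite oppr0 expR0 !expr0n/=; lra.
apply: e1 => //.
- by move=> z; apply: is_derive_eq; rewrite /GRing.scale/=; field.
- by rewrite oppr0 expR0; lra.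
Qed.

Lemma is_derive_monomial (c : R) n (z : R) :
  is_derive z 1 (fun x : R => c * x ^+ n.+1) (c * (n.+1%:R * z ^+ n)).
Proof.
have dX : is_derive z 1 (fun x : R => x ^+ n.+1) (n.+1%:R * z ^+ n).
  apply: DeriveDef; first exact: exprn_derivable.
  by rewrite exp_derive /GRing.scale/= mulr1.
by apply: is_derive_eq; rewrite /GRing.scale/=; ring.
Qed.

(** Integrates the quartic bound on [expR (- u)] at [u = x ^+ 2 / 2] from [0] to [t]. *)
Lemma Phi_le_taylor t : 0 <= t ->
  Phi t <= 2^-1 + (t - t ^+ 3 / 6 + t ^+ 5 / 40 - t ^+ 7 / 336 + t ^+ 9 / 3456)
           / Num.sqrt (2 * pi).
Proof.
move=> t0; pose r : R := (Num.sqrt (2 * pi))^-1.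
pose p0 (x : R) := r * x ^+ 1; pose p1 (x : R) := - (r / 6) * x ^+ 3.
pose p2 (x : R) := r / 40 * x ^+ 5; pose p3 (x : R) := - (r / 336) * x ^+ 7.
pose p4 (x : R) := r / 3456 * x ^+ 9.
pose f (x : R) := 2^-1 + (p0 x + p1 x + p2 x + p3 x + p4 x) - Phi x.
pose f' (x : R) :=
  r * (1 - x ^+ 2 / 2 + x ^+ 4 / 8 - x ^+ 6 / 48 + x ^+ 8 / 384) - phi x.
have df (z : R) : is_derive z 1 f (f' z).
  have d0 : is_derive z 1 p0 _ := is_derive_monomial _ 0 z.
  have d1 : is_derive z 1 p1 _ := is_derive_monomial _ 2 z.
  have d2 : is_derive z 1 p2 _ := is_derive_monomial _ 4 z.
  have d3 : is_derive z 1 p3 _ := is_derive_monomial _ 6 z.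
  have d4 : is_derive z 1 p4 _ := is_derive_monomial _ 8 z.
  have -> : f = (cst 2^-1 : R -> R) + p0 + p1 + p2 + p3 + p4 - Phi.
    by apply/funext => x; rewrite /f !fctE/= !addrA.
  by apply: is_derive_eq; rewrite /f'; field.
suff : 0 <= f t by rewrite /f /p0 /p1 /p2 /p3 /p4 -/r; lra.
have -> : 0 = f 0 by rewrite /f /p0 /p1 /p2 /p3 /p4 Phi0 !expr0n/= !mulr0; lra.
apply: (@is_derive_ge0_ndecr _ f f' 0 _ _ df) => // z z0.
rewrite /f' /Defs.phi -/r [r * _]mulrC -mulrBl; apply: mulr_ge0; last first.
  by rewrite invr_ge0 sqrtr_ge0.
rewrite mulNr subr_ge0.
have := @expRN_le_taylor4 (z ^+ 2 / 2); rewrite divr_ge0 ?sqr_ge0// => /(_ isT).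
by move=> h; apply: (le_trans h); rewrite le_eqVlt; apply/orP; left; apply/eqP; field.
Qed.

(** The supremum is informative only once the set is known to be bounded: [mills_ge0] gives
    $t^2\Phi(-t)\le t\varphi(t)$, and $t\le e^{t^2/2}$ bounds this by $(2\pi)^{-1/2}$. *)
Lemma sup_sqr_Phi_ge t : 0 <= t ->
  t ^+ 2 * Phi (- t) <= sup [set t ^+ 2 * Phi (- t) | t in [set t : R | 0 <= t]].
Proof.
move=> t0; apply: ub_le_sup; last by exists t.
exists (Num.sqrt (2 * pi))^-1 => _ [x /= x0 <-].
have := @mills_ge0 _ x; rewrite /Defs.phi.
have e : x <= expR (x ^+ 2 / 2).
  by apply: (le_trans _ (expR_ge1Dx _)); have := sqr_ge0 (x - 1); nra.
move=> h; rewrite expr2 -mulrA (le_trans (ler_wpM2l x0 h))// mulrA.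
rewrite ler_piMl ?invr_ge0 ?sqrtr_ge0// mulNr expRN ler_pdivrMr ?expR_gt0//.
by rewrite mul1r.
Qed.

(** Here [r] stands for $\sqrt{2\pi}$, so [r ^+ 2 / 4] is [pi / 2]; 269/100 is $5/4+t^2$ at $t=6/5$,
    and 557/200 rounds up $2t^2\cdot 483/500$. *)
Lemma sqrt2pi_cubic (r : R) : 12 <= 5 * r -> 500 * r <= 1257 ->
  0 <= 269 / 100 - 557 / 200 * r^-1 - r ^+ 2 / 4.
Proof.
move=> a b; have r0 : 0 < r by lra.
have a1 : 0 <= 5 * r - 12 by lra.
have a2 : 0 <= 1257 - 500 * r by lra.
(* The third root is minus the sum of the other two, so the product has no [r ^+ 2] term. It differs
   from a multiple of the target by an affine function that is nonnegative for [500 * r <= 1257]. *)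
have a3 : 0 <= 500 * r + 2457 by lra.
have h : 0 <= 269 / 100 * r - 557 / 200 - r ^+ 3 / 4.
  have := mulr_ge0 (mulr_ge0 a1 a2) a3; lra.
have -> : 269 / 100 - 557 / 200 * r^-1 - r ^+ 2 / 4 =
    (269 / 100 * r - 557 / 200 - r ^+ 3 / 4) / r.
  by field; rewrite gt_eqF.
by rewrite divr_ge0// ltW.
Qed.

(** The supremum is bounded below by the value at 6/5, where the Taylor bound on [Phi] is sharp
    enough. *)
Lemma sup_sqr_Phi_pi :
  pi / 2 <= 5 / 4 + 2 * sup [set t ^+ 2 * Phi (- t) | t in [set t : R | 0 <= t]].
Proof.
have t0 : (0 : R) <= 6 / 5 by lra.
have hS := sup_sqr_Phi_ge _ t0.
have hT : 6 / 5 - (6 / 5) ^+ 3 / 6 + (6 / 5) ^+ 5 / 40 - (6 / 5) ^+ 7 / 336 +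
   (6 / 5) ^+ 9 / 3456 <= 483 / 500 :> R by lra.
have hP : Phi (6 / 5) <= 2^-1 + 483 / 500 / Num.sqrt (2 * pi).
  apply: (le_trans (Phi_le_taylor _ t0)); rewrite lerD2l.
  by apply: (ler_wpM2r _ hT); rewrite invr_ge0 sqrtr_ge0.
move: hS hP; rewrite PhiN; move: (sup _) (Phi _) => S P hS hP.
have r2 : Num.sqrt (2 * pi) ^+ 2 = 2 * pi :> R by rewrite sqr_sqrtr// mulr_ge0// pi_ge0.
have := @sqrt2pi_gt0 R; move: (Num.sqrt (2 * pi)) r2 hP => r r2 hP r0.
have p3 := pi_ge3; have p4 := pi_le316; move: (pi : R) r2 p3 p4 => p r2 p3 p4.
(* $2.4^2<6\le 2\pi$, and below $2\pi\le6.32<2.514^2$. *)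
have rl : 12 <= 5 * r.
  by rewrite leNgt; apply/negP => h; clear -r2 p3 h r0; nra.
have ru : 500 * r <= 1257.
  by rewrite leNgt; apply/negP => h; clear -r2 p4 h r0; nra.
have := sqrt2pi_cubic _ rl ru; have : 0 < r^-1 by rewrite invr_gt0.
move: (r^-1) hP => i hP i0; rewrite r2 => h; clear -hP h hS i0; lra.
Qed.

End NumericalBounds.

(** * From a density formula on sets to one on functions *)

Section DensityTransfer.
Local Open Scope ereal_scope.
Context {d d'} {X : measurableType d} {Y : measurableType d'} {R : realType}.
Variables (mu : {measure set X -> \bar R}) (nu : {measure set Y -> \bar R}).
Variables (g : Y -> X) (k : Y -> \bar R) (D : set X).
Hypothesis mg : measurable_fun setT g.
Hypothesis mk : measurable_fun setT k.
Hypothesis k0 : forall y, 0 <= k y.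
Hypothesis muE : forall A, measurable A -> A `<=` D ->
  mu A = \int[nu]_y ((\1_A (g y))%:E * k y).

Import HBNNSimple.

(** Monotone approximation by simple functions. The formula for [mu] is assumed only inside [D],
    hence the requirement that [f] vanish outside. *)
Lemma ge0_integral_density (f : X -> R) : measurable_fun setT f ->
  (forall x, 0 <= f x)%R -> (forall x, ~ D x -> f x = 0)%R ->
  \int[mu]_x (f x)%:E = \int[nu]_y ((f (g y))%:E * k y).
Proof.
move=> mf f0 fD; have mF : measurable_fun setT (EFin \o f) by exact/measurable_EFinP.
have F0 x : setT x -> 0 <= (EFin \o f) x by rewrite lee_fin.
pose f_ := nnsfun_approx measurableT mF.
have f_le n x : (f_ n x <= f x)%R.
  by have := @le_approx _ _ _ _ _ n x F0 I; rewrite /f_ nnsfun_approxE lee_fin.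
have mfg n : measurable_fun setT (fun y => (f_ n (g y))%:E * k y).
  by apply: emeasurable_funM => //; apply/measurable_EFinP; exact: measurableT_comp.
have fg0 n y : 0 <= (f_ n (g y))%:E * k y by rewrite mule_ge0// lee_fin.
transitivity (limn (fun n => \int[mu]_x (f_ n x)%:E)).
  rewrite -monotone_convergence//.
  - by apply: eq_integral => x _; apply/esym/cvg_lim => //; exact: cvg_nnsfun_approx.
  - by move=> n; exact/measurable_EFinP.
  - by move=> n x _; rewrite lee_fin.
  - by move=> x _ m n mn; rewrite lee_fin; exact/lefP/nd_nnsfun_approx.
transitivity (limn (fun n => \int[nu]_y ((f_ n (g y))%:E * k y))); last first.
  rewrite -monotone_convergence//.
  - apply: eq_integral => y _; apply/cvg_lim => //.
    (* [k y] may be infinite, so convergence of the product needs a nonzero limit; when [f (g y)] is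
       zero the approximations vanish as well. *)
    have [fg00|fgN0] := eqVneq (f (g y)) 0%R.
      rewrite fg00 mul0e [X in X @ _ --> _](_ : _ = cst 0); first exact: cvg_cst.
      apply/funext => n; have := f_le n (g y); rewrite fg00 => h.
      by rewrite (_ : f_ n (g y) = 0%R) ?mul0e//; apply/eqP; rewrite eq_le h/=.
    under eq_fun do rewrite muleC; rewrite muleC; apply: cvgeM.
    + have [kf|kf] := boolP (k y \is a fin_num); first exact: mule_def_fin.
      by apply: mule_def_infty_neq0 => //; rewrite eqe.
    + exact: cvg_cst.
    + exact: (cvg_nnsfun_approx _ mF F0).
  - move=> y _ m n mn; apply: lee_wpmul2r => //.
    by rewrite lee_fin; exact/lefP/nd_nnsfun_approx.
congr (limn _); apply/funext => n.
have mpre r : measurable (f_ n @^-1` [set r]) by exact: measurable_sfunP.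
transitivity (\sum_(r \in range (f_ n)) \int[mu]_x (r * \1_(f_ n @^-1` [set r]) x)%:E).
  under eq_integral do rewrite fimfunE -fsumEFin//.
  rewrite ge0_integral_fsum//.
  - by move=> y; exact/measurable_EFinP/measurable_funM.
  - by move=> y x _; rewrite nnfun_muleindic_ge0.
transitivity (\sum_(r \in range (f_ n))
    \int[nu]_y ((r * \1_(f_ n @^-1` [set r]) (g y))%:E * k y)); last first.
  rewrite -ge0_integral_fsum//.
  - apply: eq_integral => y _; rewrite [in RHS]fimfunE -fsumEFin//.
    rewrite ge0_mule_fsuml// => r.
    by rewrite nnfun_muleindic_ge0.
  - move=> r; apply: emeasurable_funM => //; apply/measurable_EFinP.
    by apply: measurable_funM => //; apply: measurableT_comp => //; exact: measurable_indic.
  - by move=> r y _; rewrite mule_ge0// nnfun_muleindic_ge0.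
apply: eq_fsbigr => r; rewrite inE => -[x0 _ rE].
have r0 : (0 <= r)%R by rewrite -rE.
(* The level set of the value [0] may leave [D], where [muE] says nothing, but it contributes
   nothing to either side. *)
have [->|rn0] := eqVneq r 0%R.
  under eq_integral do rewrite mul0r.
  by under [in RHS]eq_integral do rewrite mul0r mul0e; rewrite !integral0.
have rpos : (0 < r)%R by rewrite lt_neqAle eq_sym rn0.
(* A level set of a positive value lies in [D], because [f_ n] is below [f]. *)
rewrite integralZl_indic_nnsfun// integral_indic// setIT muE//; last first.
  by move=> x /= xr; apply: contrapT => /fD fx0; have := f_le n x; rewrite xr fx0 leNgt rpos.
rewrite -ge0_integralZl//.
- by apply: eq_integral => y _; rewrite muleA -EFinM.
- apply: emeasurable_funM => //; apply/measurable_EFinP.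
  by apply: measurableT_comp => //; exact: measurable_indic.
- by move=> y _; rewrite mule_ge0// lee_fin.
Qed.
End DensityTransfer.

(** * The kernel on the positive half-line as a Gaussian minus its mirror image *)

Section StickyKernel.
Context {R : realType}.
Local Notation leb := (@lebesgue_measure R).
Local Notation phi := (@phi R).
Local Notation Phi := (@Phi R).
Implicit Types a b g s t w x y : R.

(** The transition density at unit time of Brownian motion started at [b] and killed at [0]. *)
Definition sticky_density b t : R := phi (t - b) - phi (t + b).

(** The variable [t] is the new point divided by [2 * s]. The atom at [0] is left out, so this is
    the action of the kernel on functions vanishing at [0]. *)
Definition sticky_op s (f : R -> R) a : \bar R :=
  (\int[leb]_(t in `[0%R, +oo[) (f (2 * s * t) * sticky_density (a / (2 * s)) t)%:E)%E.

Lemma phi_le x y : `|x| <= `|y| -> phi y <= phi x.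
Proof.
move=> xy; rewrite ler_pM2r ?invr_gt0 ?sqrt2pi_gt0// ler_expR.
rewrite ler_pM2r ?invr_gt0// lerN2 -(real_normK (num_real x)) -(real_normK (num_real y)).
by rewrite ler_pXn2r ?nnegrE.
Qed.

Lemma sticky_density_ge0 b t : 0 <= b -> 0 <= t -> 0 <= sticky_density b t.
Proof.
move=> b0 t0; rewrite subr_ge0 phi_le// ler_norml (ger0_norm (addr_ge0 t0 b0)).
by apply/andP; split; lra.
Qed.

(** The quotient of the two scaled densities is [phi (a / s - g) / phi g], so the mass sent to [0]
    is the overlap of two Gaussians. *)
Lemma pbar_phi s a g : 0 < s ->
  pbar (s ^+ 2) a g * phi g = Num.min (phi g) (phi (a / s - g)).
Proof.
move=> s0; rewrite /pbar sqrtr_sqr gtr0_norm//.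
have c0 : 0 < Num.sqrt (2 * pi * s ^+ 2).
  by rewrite sqrtr_gt0 !mulr_gt0 ?pi_gt0 ?exprn_gt0.
have -> : phis (s ^+ 2) (a - s * g) / phis (s ^+ 2) (s * g) = phi (a / s - g) / phi g.
  rewrite /phis /Defs.phi -!mulf_div mulfV ?invr_neq0 ?gt_eqF// mul1r.
  rewrite mulfV ?invr_neq0 ?gt_eqF ?sqrt2pi_gt0// mulr1.
  by rewrite -!expRN -!expRD; congr expR; field; rewrite gt_eqF.
by rewrite mulrC minr_pMr ?phi_ge0// mulr1 [phi g * _]mulrC divfK// gt_eqF// phi_gt0.
Qed.

Lemma Qker_sticky_op (sigma cinf gamma : R) (tg : R -> R) w (A : set R) :
  0 < sigma -> 0 < gamma -> 0 <= tg w + gamma * cinf ->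
  measurable A -> A `<=` [set x | 0 < x] ->
  Qker sigma cinf gamma tg w A =
  sticky_op (sigma * Num.sqrt gamma) \1_A (tg w + gamma * cinf).
Proof.
move=> s0 g0 a0 mA A0; rewrite /Qker; set a := tg w + _ in a0 *.
set s := sigma * Num.sqrt gamma.
have sp : 0 < s by rewrite mulr_gt0// sqrtr_gt0.
have -> : sigma ^+ 2 * gamma = s ^+ 2 by rewrite exprMn sqr_sqrtr// ltW.
rewrite diracE memNset ?mul0e ?add0e; last by move=> /A0/=; rewrite ltxx.
pose h x := phi x - Num.min (phi x) (phi (a / s - x)).
have mh : measurable_fun setT h.
  apply: measurable_funB; first exact: measurable_phi.
  apply: measurable_minr; first exact: measurable_phi.
  by apply: (measurableT_comp measurable_phi); exact: measurable_funB.
have hE x : (1 - pbar (s ^+ 2) a x) * phi x = h x.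
  by rewrite mulrBl mul1r pbar_phi.
have h0 x : 0 <= h x by rewrite subr_ge0 ge_min lexx.
have mF : measurable_fun setT (fun x : R => (\1_A (a - 2 * sigma * Num.sqrt gamma * x) *
    (1 - pbar (s ^+ 2) a x) * phi x)%:E).
  apply/measurable_EFinP; under eq_fun do rewrite -mulrA hE.
  apply: measurable_funM => //; apply: measurableT_comp => //.
  by apply: measurable_funB => //; exact: measurable_funM.
(* With [g = a / (2 * s) - t] the new point is [2 * s * t], and for [0 <= t] the smaller of the two
   Gaussians is the mirror image [phi (t + a / (2 * s))]. *)
rewrite (ge0_integral_reflect (a / (2 * s)))//; last first.
  by move=> x; rewrite lee_fin -mulrA hE mulr_ge0.
rewrite /sticky_op [RHS]integral_mkcond; apply: eq_integral => t _.
rewrite /patch mem_setE in_itv/= andbT -mulrA hE.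
have -> : a - 2 * sigma * Num.sqrt gamma * (a / (2 * s) - t) = 2 * s * t.
  by rewrite -[2 * sigma * _]mulrA -/s; field; rewrite gt_eqF.
case: ifPn => [t0|]; last first.
  rewrite -ltNge => t0; rewrite indicE memNset ?mul0r// => /A0 /=.
  have s2 : 0 < 2 * s by exact: mulr_gt0.
  by rewrite pmulr_rgt0// => /(lt_trans t0); rewrite ltxx.
congr (_ * _)%:E; rewrite /h /sticky_density.
have -> : a / s - (a / (2 * s) - t) = t + a / (2 * s) by field; rewrite gt_eqF.
rewrite -phiN opprB; congr (_ - _); apply/min_idPr.
have b0 : 0 <= a / (2 * s) by rewrite divr_ge0// mulr_ge0// ltW.
by rewrite -subr_ge0 sticky_density_ge0.
Qed.

Section Stationary.
Variables (mu : probability R R) (beta : R -> R) (s : R).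
Hypotheses (s0 : 0 < s) (mbeta : measurable_fun setT beta)
  (beta0 : forall w, 0 <= beta w).

(** Under stationarity this is the density of [mu] on the positive half-line in the variable [t],
    for points written [2 * s * t]. *)
Let kappa (t : R) : \bar R := (\int[mu]_w
  (\1_(`[0%R, +oo[%classic : set R) t * sticky_density (beta w / (2 * s)) t)%:E)%E.

Let dens0 w t : 0 <= \1_(`[0%R, +oo[%classic : set R) t * sticky_density (beta w / (2 * s)) t.
Proof.
rewrite indicE mem_setE in_itv/= andbT; case: (leP 0 t) => t0; last by rewrite mul0r.
have b0 : 0 <= beta w / (2 * s).
  by apply: divr_ge0 => //; apply: mulr_ge0 => //; exact: ltW.
by rewrite mul1r sticky_density_ge0.
Qed.

Let mdens : measurable_fun setT (fun z : R * R =>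
  \1_(`[0%R, +oo[%classic : set R) z.2 * sticky_density (beta z.1 / (2 * s)) z.2).
Proof.
apply: measurable_funM.
  by apply: measurableT_comp => //; exact: measurable_indic.
have mb : measurable_fun setT (fun z : R * R => beta z.1 / (2 * s)).
  by apply: measurable_funM => //; exact: measurableT_comp.
by apply: measurable_funB; apply: (measurableT_comp measurable_phi);
  [exact: measurable_funB|exact: measurable_funD].
Qed.

Let integral_sticky_op (f : R -> R) : measurable_fun setT f -> (forall x, 0 <= f x) ->
  (\int[mu]_w sticky_op s f (beta w) = \int[leb]_t ((f (2 * s * t))%:E * kappa t))%E.
Proof.
move=> mf f0.
pose F (z : R * measurableTypeR R) : \bar R := (f (2 * s * z.2) *
  (\1_(`[0%R, +oo[%classic : set R) z.2 * sticky_density (beta z.1 / (2 * s)) z.2))%:E.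
have F0 z : (0 <= F z)%E by rewrite lee_fin mulr_ge0// dens0.
have mF : measurable_fun setT F.
  apply/measurable_EFinP; apply: measurable_funM; last exact: mdens.
  by apply: (measurableT_comp mf); exact: measurable_funM.
transitivity (\int[mu]_w \int[leb]_t F (w, t))%E.
  apply: eq_integral => w _; rewrite /sticky_op integral_mkcond.
  apply: eq_integral => t _; rewrite /patch /F/= indicE.
  by case: ifP; rewrite ?mul1r// mul0r mulr0.
rewrite fubini_tonelli//; apply: eq_integral => t _; rewrite /F/=.
under eq_integral do rewrite EFinM.
rewrite ge0_integralZl//.
- apply/measurable_EFinP.
  exact: (measurableT_comp mdens (measurable_pair2 t)).
- by move=> w _; rewrite lee_fin dens0.
- by rewrite lee_fin.
Qed.

Lemma measurable_sticky_op (f : R -> R) : measurable_fun setT f ->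
  (forall x, 0 <= f x) -> measurable_fun setT (fun w => sticky_op s f (beta w)).
Proof.
move=> mf f0.
pose F (z : R * measurableTypeR R) : \bar R := (f (2 * s * z.2) *
  (\1_(`[0%R, +oo[%classic : set R) z.2 * sticky_density (beta z.1 / (2 * s)) z.2))%:E.
have F0 z : (0 <= F z)%E by rewrite lee_fin mulr_ge0// dens0.
have mF : measurable_fun setT F.
  apply/measurable_EFinP; apply: measurable_funM; last exact: mdens.
  by apply: (measurableT_comp mf); exact: measurable_funM.
have := @measurable_fun_fubini_tonelli_F _ _ _ _ _ leb F mF F0.
rewrite (_ : fubini_F leb F = (fun w => sticky_op s f (beta w)))//.
apply/funext => w; rewrite /sticky_op integral_mkcond /fubini_F.
apply: eq_integral => t _; rewrite /patch /F/= indicE.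
by case: ifP; rewrite ?mul1r// mul0r mulr0.
Qed.

(** Averaging the kernel over [mu] gives the positive part of [mu] the density [kappa]; the density
    formula then passes from sets to functions carried by the positive half-line. *)
Lemma sticky_stationary :
  (forall A : set R, measurable A -> A `<=` [set x : R | 0 < x] ->
    mu A = (\int[mu]_w sticky_op s \1_A (beta w))%E) ->
  forall f : R -> R, measurable_fun setT f -> (forall x, 0 <= f x) ->
  (forall x, x <= 0 -> f x = 0) ->
  (\int[mu]_x (f x)%:E = \int[mu]_w sticky_op s f (beta w))%E.
Proof.
move=> muE f mf f0 fN; rewrite integral_sticky_op//.
apply: (@ge0_integral_density _ _ _ _ _ mu leb (fun t => 2 * s * t) kappa [set x : R | 0 < x]) => //.
- exact: measurable_funM.
- pose F (z : R * measurableTypeR R) : \bar R :=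
    (\1_(`[0%R, +oo[%classic : set R) z.2 * sticky_density (beta z.1 / (2 * s)) z.2)%:E.
  have mF : measurable_fun setT F by apply/measurable_EFinP; exact: mdens.
  by apply: (measurable_fun_fubini_tonelli_G F mF) => z; rewrite lee_fin dens0.
- by move=> t; apply: integral_ge0 => w _; rewrite lee_fin dens0.
- by move=> A mA A0; apply: (etrans (muE A mA A0)); exact: integral_sticky_op.
- by move=> x /= /negP; rewrite -leNgt => /fN.
Qed.

End Stationary.

End StickyKernel.

(** * Action of the operator on the test functions *)

Section StickyOperator.
Context {R : realType}.
Local Notation leb := (@lebesgue_measure R).
Local Notation phi := (@phi R).
Local Notation Phi := (@Phi R).
Implicit Types a b s t x y : R.

Lemma measurable_sticky_density b : measurable_fun setT (sticky_density b).
Proof.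
apply: measurable_funB; first exact: measurable_phiB.
by apply: (measurableT_comp measurable_phi); exact: measurable_funD.
Qed.

(** The finite [v] is added back before integrals are combined, so that every integrand stays
    nonnegative. *)
Lemma sticky_moment (f : R -> R) b (u v : R) : 0 <= b ->
  measurable_fun setT f -> (forall t, 0 <= t -> 0 <= f t) ->
  (\int[leb]_(t in `[0%R, +oo[) (f t * phi (t - b))%:E = u%:E)%E ->
  (\int[leb]_(t in `[0%R, +oo[) (f t * phi (t - - b))%:E = v%:E)%E ->
  (\int[leb]_(t in `[0%R, +oo[) (f t * sticky_density b t)%:E = (u - v)%:E)%E.
Proof.
move=> b0 mf f0 hu hv; rewrite EFinB -hu.
rewrite -[LHS](@addeK _ v%:E)//; congr (_ - _)%E; rewrite -hv -ge0_integralD//=.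
- apply: eq_integral => t _; rewrite -EFinD; congr EFin.
  by rewrite /sticky_density opprK; ring.
- move=> t; rewrite in_itv/= andbT => t0.
  by rewrite lee_fin mulr_ge0 ?f0 ?sticky_density_ge0.
- apply: measurable_funTS; apply/measurable_EFinP.
  by apply: measurable_funM => //; exact: measurable_sticky_density.
- move=> t; rewrite in_itv/= andbT => t0.
  by rewrite lee_fin mulr_ge0 ?f0 ?phi_ge0.
- apply: measurable_funTS; apply/measurable_EFinP.
  by apply: measurable_funM => //; exact: measurable_phiB.
Qed.

Lemma sticky_moment0 b : 0 <= b ->
  (\int[leb]_(t in `[0%R, +oo[) (1 * sticky_density b t)%:E = (2 * Phi b - 1)%:E)%E.
Proof.
move=> b0; rewrite (@sticky_moment (cst 1) _ (Phi b) (Phi (- b)))//.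
- by rewrite PhiN; congr EFin; ring.
- by under eq_integral do rewrite mul1r; exact: integral_phi_shift.
- by under eq_integral do rewrite mul1r; exact: integral_phi_shift.
Qed.

(** For odd powers, as here and in [sticky_moment3], the mirror image turns the half-line moment
    into the whole-line moment of $N(b,1)$; even powers keep a term in [Phi]. *)
Lemma sticky_moment1 b : 0 <= b ->
  (\int[leb]_(t in `[0%R, +oo[) (t * sticky_density b t)%:E = b%:E)%E.
Proof.
move=> b0; have m1 := @gaussian_moment1 R.
rewrite (sticky_moment _ _ _ _ b0 _ _ (m1 b) (m1 (- b)))//.
by rewrite phiN PhiN; congr EFin; ring.
Qed.

Lemma sticky_moment2 b : 0 <= b ->
  (\int[leb]_(t in `[0%R, +oo[) (t ^+ 2 * sticky_density b t)%:E =
   ((1 + b ^+ 2) * (2 * Phi b - 1) + 2 * b * phi b)%:E)%E.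
Proof.
move=> b0; have m2 := @gaussian_moment2 R.
rewrite (sticky_moment _ _ _ _ b0 _ _ (m2 b) (m2 (- b)))//.
- by rewrite phiN PhiN; congr EFin; ring.
- by move=> t _; exact: sqr_ge0.
Qed.

Lemma sticky_moment3 b : 0 <= b ->
  (\int[leb]_(t in `[0%R, +oo[) (t ^+ 3 * sticky_density b t)%:E =
   (b ^+ 3 + 3 * b)%:E)%E.
Proof.
move=> b0; have m3 := @gaussian_moment3 R.
rewrite (sticky_moment _ _ _ _ b0 _ _ (m3 b) (m3 (- b)))//.
- by rewrite phiN PhiN; congr EFin; ring.
- by move=> t t0; exact: exprn_ge0.
Qed.

Variable s : R.
Hypothesis s0 : 0 < s.

Let s2 : 0 < 2 * s. Proof. exact: mulr_gt0. Qed.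

Let b_ge0 a : 0 <= a -> 0 <= a / (2 * s).
Proof. by move=> a0; rewrite divr_ge0// ltW. Qed.

Lemma le_sticky_op (f g : R -> R) a : 0 <= a ->
  measurable_fun setT f -> measurable_fun setT g ->
  (forall x, 0 < x -> 0 <= f x <= g x) -> (sticky_op s f a <= sticky_op s g a)%E.
Proof.
move=> a0 mf mg fg; have mx (h : R -> R) : measurable_fun setT h ->
    measurable_fun (`[0%R, +oo[%classic : set R) (fun t : R => (h (2 * s * t) * sticky_density (a / (2 * s)) t)%:E).
  move=> mh; apply: measurable_funTS; apply/measurable_EFinP.
  apply: measurable_funM; last exact: measurable_sticky_density.
  by apply: (measurableT_comp mh); exact: measurable_funM.
(* The Gaussian and its mirror image cancel at [0], so values of the test functions at [0] do not
   matter. *)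
have d0 : sticky_density (a / (2 * s)) 0 = 0.
  by rewrite /sticky_density sub0r add0r phiN subrr.
apply: ge0_le_integral => //=; [|exact: mx|exact: mx|].
- move=> t; rewrite in_itv/= andbT le_eqVlt => /orP[/eqP<-|t0].
    by rewrite d0 mulr0.
  rewrite lee_fin; apply: mulr_ge0; last first.
    by apply: sticky_density_ge0; [exact: b_ge0|exact: ltW].
  by have /andP[] := fg (2 * s * t) (mulr_gt0 s2 t0).
- move=> t; rewrite in_itv/= andbT le_eqVlt => /orP[/eqP<-|t0].
    by rewrite d0 !mulr0.
  rewrite lee_fin; apply: ler_wpM2r.
    by apply: sticky_density_ge0; [exact: b_ge0|exact: ltW].
  by have /andP[] := fg (2 * s * t) (mulr_gt0 s2 t0).
Qed.

Lemma sticky_op_cst c a : 0 <= a -> 0 <= c ->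
  sticky_op s (cst c) a = (c * (2 * Phi (a / (2 * s)) - 1))%:E.
Proof.
move=> a0 c0; rewrite /sticky_op EFinM -sticky_moment0 ?b_ge0//.
rewrite -ge0_integralZl//=.
- by apply: eq_integral => t _; rewrite mul1r.
- apply: measurable_funTS; apply/measurable_EFinP; apply: measurable_funM => //.
  exact: measurable_sticky_density.
- move=> t; rewrite in_itv/= andbT => t0.
  by rewrite lee_fin mul1r sticky_density_ge0 ?b_ge0.
Qed.

Lemma eq_sticky_op (f g : R -> R) a : 0 <= a ->
  (forall x, 0 < x -> f x = g x) -> sticky_op s f a = sticky_op s g a.
Proof.
move=> a0 fg; apply: eq_integral => t; rewrite inE/= in_itv/= andbT.
rewrite le_eqVlt => /orP[/eqP<-|t0].
  by rewrite /sticky_density sub0r add0r phiN subrr !mulr0.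
by rewrite fg// mulr_gt0.
Qed.

Lemma sticky_op_id a : 0 <= a -> sticky_op s id a = a%:E.
Proof.
move=> a0; have := sticky_moment1 _ (b_ge0 _ a0) => e.
have -> : a%:E = ((2 * s)%:E * (a / (2 * s))%:E)%E.
  by rewrite -EFinM; congr EFin; field; rewrite gt_eqF.
rewrite -e -ge0_integralZl//=.
- by apply: eq_integral => t _; rewrite -EFinM mulrA.
- apply: measurable_funTS; apply/measurable_EFinP; apply: measurable_funM => //.
  exact: measurable_sticky_density.
- move=> t; rewrite in_itv/= andbT => t0.
  by rewrite lee_fin mulr_ge0 ?sticky_density_ge0 ?b_ge0.
- by rewrite lee_fin ltW.
Qed.

(** Jensen's inequality for a concave function, read off from its two bounding affine functions. *)
Lemma sticky_op_min_le (N a : R) : 0 <= N -> 0 <= a ->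
  (sticky_op s (fun x => Num.min x N) a <= (Num.min a N)%:E)%E.
Proof.
move=> N0 a0; have mm : measurable_fun setT (fun x : R => Num.min x N).
  exact: measurable_minr.
rewrite EFin_min le_min; apply/andP; split.
  rewrite -sticky_op_id//; apply: le_sticky_op => // x x0.
  by rewrite le_min (ltW x0) N0 ge_min lexx.
apply: (@le_trans _ _ (sticky_op s (cst N) a)).
  apply: le_sticky_op => // x x0.
  by rewrite le_min (ltW x0) N0 ge_min lexx orbT.
rewrite sticky_op_cst// lee_fin ler_piMr//.
by have := @Phi_le1 R (a / (2 * s)); lra.
Qed.

(** In terms of the slope, one application adds $4s^2$ to $r^{-2}$. *)
Lemma sticky_op_Phi (r a : R) : 0 <= r -> 0 <= a ->
  sticky_op s (fun x => 2 * Phi (r * x) - 1) a =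
  (2 * Phi (r * a / Num.sqrt (1 + 4 * s ^+ 2 * r ^+ 2)) - 1)%:E.
Proof.
move=> r0 a0; have rs0 : 0 <= r * (2 * s) by rewrite mulr_ge0// ltW.
have e := sticky_Phi _ _ rs0 (b_ge0 _ a0).
have -> : r * a = r * (2 * s) * (a / (2 * s)) by field; rewrite gt_eqF.
have -> : 4 * s ^+ 2 * r ^+ 2 = (r * (2 * s)) ^+ 2 by ring.
by rewrite -e; apply: eq_integral => t _; rewrite /sticky_density !mulrA.
Qed.

(** On [[0, A]] this is $3A^2y-3Ay^2+y^3$, and it is constant beyond [A]; on the half-line it is
    increasing and concave, and has explicit moments up to truncation. *)
Definition cubic_cap (A y : R) : R := A ^+ 3 - (Num.max 0 (A - y)) ^+ 3.

Lemma measurable_cubic_cap A : measurable_fun setT (cubic_cap A).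
Proof.
apply: measurable_funB => //; apply: measurable_funX; apply: measurable_maxr => //.
exact: measurable_funB.
Qed.

Lemma cubic_cap_itv A y : 0 < A -> 0 <= y -> 0 <= cubic_cap A y <= A ^+ 3.
Proof.
move=> A0 y0; have A30 : 0 <= A ^+ 3 by rewrite exprn_ge0// ltW.
rewrite /cubic_cap; case: (leP 0 (A - y)) => h.
  rewrite gerBl exprn_ge0// andbT subr_ge0 ler_pXn2r//; first by lra.
  by rewrite nnegrE ltW.
by rewrite expr0n/= subr0 A30 lexx.
Qed.

(** The cubic polynomial exceeds the truncated one only beyond [A], by $(y-A)^3$. *)
Lemma cubic_cap_le A y : 0 < A -> 0 <= y ->
  cubic_cap A y + 3 * A * y ^+ 2 <= 3 * A ^+ 2 * y + y ^+ 3.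
Proof.
move=> A0 y0; rewrite /cubic_cap; case: (leP 0 (A - y)) => h; first by lra.
have : 0 <= (y - A) ^+ 3 by rewrite exprn_ge0//; lra.
rewrite expr0n/=; lra.
Qed.

(** A quantitative Jensen inequality: the term in [2 * Phi (a / (2 * s)) - 1] is the gain that later
    becomes the mass of the positive half-line. *)
Lemma sticky_op_cubic_cap (A a : R) : 0 < A -> 0 <= a ->
  (sticky_op s (cubic_cap A) a + (12 * A * s ^+ 2 * (2 * Phi (a / (2 * s)) - 1))%:E
   <= (cubic_cap A a + 12 * s ^+ 2 * a)%:E)%E.
Proof.
move=> A0 a0; set b := a / (2 * s); have b0 : 0 <= b by exact: b_ge0.
have aE : a = 2 * s * b by rewrite /b; field; rewrite gt_eqF.
have mc := measurable_cubic_cap A.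
have P1 := @Phi_le1 R b; have P2 := Phi_ge_half b b0.
have s20 : 0 < s ^+ 2 by rewrite exprn_gt0.
(* Beyond [A] the bound by the constant [A ^+ 3] suffices; below [A] the untruncated cubic and its
   moments are used. *)
have [aA|aA] := leP a A; last first.
  apply: (@le_trans _ _ (sticky_op s (cst (A ^+ 3)%R) a +
     (12 * A * s ^+ 2 * (2 * Phi b - 1))%:E)%E).
    apply: leeD => //; apply: le_sticky_op => // x x0.
    exact: cubic_cap_itv A0 (ltW x0).
  have A30 : 0 <= A ^+ 3 by rewrite exprn_ge0// ltW.
  rewrite sticky_op_cst// -EFinD lee_fin -/b.
  have -> : cubic_cap A a = A ^+ 3.
    by rewrite /cubic_cap; case: (leP 0 (A - a)) => h; [lra|rewrite expr0n/= subr0].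
  apply: lerD; first by apply: ler_piMr => //; lra.
  have -> : 12 * A * s ^+ 2 * (2 * Phi b - 1) = 12 * s ^+ 2 * (A * (2 * Phi b - 1)) by ring.
  apply: ler_wpM2l; first by rewrite mulr_ge0// ltW.
  by apply: (le_trans _ (ltW aA)); apply: ler_piMr; [exact: ltW|lra].
have AE : cubic_cap A a = 3 * A ^+ 2 * a - 3 * A * a ^+ 2 + a ^+ 3.
  by rewrite /cubic_cap; case: (leP 0 (A - a)) => h; [ring|lra].
pose k t := sticky_density b t.
have mk : measurable_fun setT k by exact: measurable_sticky_density.
have k0 (t : R) : 0 <= t -> 0 <= k t by exact: sticky_density_ge0.
have I (c : R) (f : R -> R) : 0 <= c -> measurable_fun setT f ->
   (forall t, 0 <= t -> 0 <= f t) ->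
   (\int[leb]_(t in `[0%R, +oo[) (c * (f t * k t))%:E =
    c%:E * \int[leb]_(t in `[0%R, +oo[) (f t * k t)%:E)%E.
  move=> c0 mf f0; under eq_integral do rewrite EFinM.
  rewrite ge0_integralZl//=.
  - by apply: measurable_funTS; apply/measurable_EFinP; exact: measurable_funM.
  - move=> t; rewrite in_itv/= andbT => t0.
    by rewrite lee_fin mulr_ge0 ?k0 ?f0.
have e1 := sticky_moment1 _ b0; have e2 := sticky_moment2 _ b0.
have e3 := sticky_moment3 _ b0.
have c1 : 0 <= 3 * A ^+ 2 * (2 * s) by rewrite ltW// mulr_gt0// mulr_gt0// exprn_gt0.
have c2 : 0 <= 12 * A * s ^+ 2 by rewrite ltW// mulr_gt0// mulr_gt0.
have c3 : 0 <= 8 * s ^+ 3 by rewrite ltW// mulr_gt0// exprn_gt0.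
have := I _ _ c2 (exprn_measurable 2) (fun t _ => sqr_ge0 t).
have h1 (t : R) : 0 <= t -> 0 <= id t by [].
have := I _ _ c1 (@measurable_id _ _ setT) h1.
have h3 (t : R) : 0 <= t -> 0 <= t ^+ 3 by exact: exprn_ge0.
have := I _ _ c3 (exprn_measurable 3) h3.
rewrite e1 e2 e3 -!EFinM => i3 i1 i2.
(* The negative quadratic term stays on the left, so that all integrands are nonnegative. *)
have : (sticky_op s (cubic_cap A) a +
    \int[leb]_(t in `[0%R, +oo[) (12 * A * s ^+ 2 * (t ^+ 2 * k t))%:E <=
    \int[leb]_(t in `[0%R, +oo[) (3 * A ^+ 2 * (2 * s) * (t * k t))%:E +
    \int[leb]_(t in `[0%R, +oo[) (8 * s ^+ 3 * (t ^+ 3 * k t))%:E)%E.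
  have mcs : measurable_fun setT (fun t => cubic_cap A (2 * s * t)).
    by apply: (measurableT_comp mc); exact: measurable_funM.
  have ct t : 0 <= t -> 0 <= cubic_cap A (2 * s * t).
    by move=> t0; have /andP[] := cubic_cap_itv A (2 * s * t) A0 (mulr_ge0 (ltW s2) t0).
  have mE (f : R -> R) : measurable_fun setT f ->
      measurable_fun (`[0%R, +oo[%classic : set R) (fun t : R => (f t)%:E).
    by move=> mf; apply: measurable_funTS; exact/measurable_EFinP.
  have mp n (c : R) : measurable_fun setT (fun t : R => c * (t ^+ n * k t)).
    by apply: measurable_funM => //; apply: measurable_funM => //; exact: exprn_measurable.
  rewrite /sticky_op -!ge0_integralD//=.
  - apply: ge0_le_integral => //=.
    + move=> t; rewrite in_itv/= andbT => t0; rewrite -EFinD lee_fin.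
      by rewrite addr_ge0// mulr_ge0 ?ct ?k0 ?c2// mulr_ge0 ?sqr_ge0 ?k0.
    + apply: mE; apply: measurable_funD; last exact: mp.
      exact: measurable_funM.
    + apply: mE; apply: measurable_funD; last exact: mp.
      exact: (mp 1%N).
    + move=> t; rewrite in_itv/= andbT => t0; rewrite -!EFinD lee_fin.
      have := cubic_cap_le A (2 * s * t) A0 (mulr_ge0 (ltW s2) t0).
      move=> /(ler_wpM2r (k0 t t0)); rewrite -/b -/(k t); move: (cubic_cap _ _) => C; lra.
  - by move=> t; rewrite in_itv/= andbT => t0; rewrite lee_fin mulr_ge0 ?c1// mulr_ge0 ?k0.
  - by apply: mE; exact: (mp 1%N).
  - move=> t; rewrite in_itv/= andbT => t0.
    by rewrite lee_fin mulr_ge0 ?c3// mulr_ge0 ?k0// exprn_ge0.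
  - by apply: mE; exact: mp.
  - by move=> t; rewrite in_itv/= andbT => t0; rewrite lee_fin mulr_ge0 ?ct ?k0.
  - by apply: mE; exact: measurable_funM.
  - move=> t; rewrite in_itv/= andbT => t0.
    by rewrite lee_fin mulr_ge0 ?c2// mulr_ge0 ?k0// sqr_ge0.
  - by apply: mE; exact: mp.
rewrite i1 i2 i3 -EFinD -leeBrDr// -EFinB => h.
rewrite -leeBrDr// -EFinB; apply: (le_trans h); rewrite lee_fin AE aE.
have M := mills_ge0 b; rewrite PhiN in M.
(* The whole slack after inserting the three moments; its last factor is nonnegative by the Mills
   bound [M]. *)
suff : 0 <= 24 * A * s ^+ 2 * b * (phi b - b * (1 - Phi b)) by lra.
apply: mulr_ge0; last by rewrite subr_ge0.
by apply: mulr_ge0 => //; rewrite ltW// mulr_gt0// mulr_gt0.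
Qed.

End StickyOperator.

Lemma cubic_cap_nd {R : realType} (A x y : R) : x <= y -> cubic_cap A x <= cubic_cap A y.
Proof.
move=> xy; rewrite /cubic_cap lerD2l lerN2; apply: lerXn2r.
- by rewrite nnegrE le_max lexx.
- by rewrite nnegrE le_max lexx.
- by rewrite ge_max !le_max lexx lerD2l lerN2 xy orbT.
Qed.

(** Concavity: the graph lies below its tangent, whose slope at [y] is
    [3 * Num.max 0 (A - y) ^+ 2]. *)
Lemma cubic_cap_shift {R : realType} (A y d : R) : 0 <= d ->
  cubic_cap A (y + d) <= cubic_cap A y + 3 * Num.max 0 (A - y) ^+ 2 * d.
Proof.
move=> d0; rewrite /cubic_cap.
have [h|h] := leP 0 (A - y); have [h'|h'] := leP 0 (A - (y + d)).
- have : 0 <= d ^+ 2 * (3 * (A - y) - d) by rewrite mulr_ge0 ?sqr_ge0//; lra.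
  lra.
- have : 0 <= (A - y) ^+ 2 * (d - (A - y)) by rewrite mulr_ge0 ?sqr_ge0//; lra.
  have : 0 <= (A - y) ^+ 2 * d by rewrite mulr_ge0 ?sqr_ge0.
  rewrite expr0n/=; lra.
- lra.
- by rewrite !expr0n/= mulr0 mul0r addr0.
Qed.

(** * Integrating pointwise inequalities between bounded functions *)

Section BoundedIntegral.
Context {d} {T : measurableType d} {R : realType} (mu : probability T R).
Implicit Types (f g : T -> R) (A B : set T).

Lemma integrable_bounded f (C : R) : measurable_fun setT f ->
  (forall x, 0 <= f x <= C) -> mu.-integrable setT (EFin \o f).
Proof.
move=> mf fC; apply: measurable_bounded_integrable => //.
  by rewrite (le_lt_trans (probability_le1 _ _))// ltry.
exists C; split; first exact: num_real.
move=> y Cy x _ /=; have /andP[f0 fle] := fC x.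
by rewrite ger0_norm// (le_trans fle)// ltW.
Qed.

Lemma EFin_bounded_integral f (C : R) : measurable_fun setT f ->
  (forall x, 0 <= f x <= C) -> (\int[mu]_x (f x))%:E = (\int[mu]_x (f x)%:E)%E.
Proof.
move=> mf fC; rewrite /Rintegral fineK//.
exact: integrable_fin_num (integrable_bounded _ _ mf fC).
Qed.

(** Boundedness makes everything integrable, and total mass one turns the constant [k2] into itself;
    the indicators become real masses. *)
Lemma le_bounded_integral f g (C k1 k2 k3 : R) A B :
  measurable_fun setT f -> measurable_fun setT g ->
  measurable A -> measurable B ->
  (forall x, 0 <= f x <= C) -> (forall x, 0 <= g x <= C) ->
  (forall x, f x + k1 * \1_A x <= g x + k2 + k3 * \1_B x) ->
  \int[mu]_x (f x) + k1 * fine (mu A) <= \int[mu]_x (g x) + k2 + k3 * fine (mu B).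
Proof.
move=> mf mg mA mB fC gC fg.
have iE (D : set T) : measurable D -> mu.-integrable setT (EFin \o \1_D).
  move=> mD; apply: (integrable_bounded _ 1); first exact: measurable_indic.
  by move=> x; rewrite indicE; case: (x \in D); rewrite ?lexx ?ler01.
have iM (k : R) (D : set T) : measurable D ->
    mu.-integrable setT (EFin \o (fun x => k * \1_D x)).
  by move=> mD; have := integrableZl measurableT k (iE _ mD).
have eI (k : R) (D : set T) : measurable D ->
    \int[mu]_x (k * \1_D x) = k * fine (mu D).
  move=> mD; rewrite RintegralZl//; last exact: iE.
  by congr (_ * _); rewrite /Rintegral integral_indic// setIT.
have iF := integrable_bounded _ _ mf fC; have iG := integrable_bounded _ _ mg gC.
have ik : mu.-integrable setT (EFin \o cst k2).
  by apply: finite_measure_integrable_cst.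
have ek : \int[mu]_x (cst k2 x) = k2.
  have e1 : fine (mu setT) = 1 by rewrite probability_setT.
  by rewrite Rintegral_cst// -[RHS]mulr1 -e1.
rewrite -(eI _ _ mA) -(eI _ _ mB) -[X in _ + X + _]ek.
have iGk : mu.-integrable setT (EFin \o (fun x => g x + cst k2 x)).
  exact: (integrableD measurableT iG ik).
rewrite -!RintegralD//; [|exact: iM|exact: iM].
apply: le_Rintegral => //; first exact: (integrableD measurableT iF (iM k1 A mA)).
exact: (integrableD measurableT iGk (iM k3 B mB)).
Qed.

Lemma le_bounded_integralD f g (C k : R) :
  measurable_fun setT f -> measurable_fun setT g ->
  (forall x, 0 <= f x <= C) -> (forall x, 0 <= g x <= C) ->
  (forall x, f x <= g x + k) ->
  \int[mu]_x (f x) <= \int[mu]_x (g x) + k.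
Proof.
move=> mf mg fC gC fg.
have := le_bounded_integral f g C 0 k 0 set0 set0 mf mg measurable0 measurable0 fC gC.
rewrite !mul0r !addr0; apply => x.
by rewrite !mul0r !addr0.
Qed.

Lemma le_bounded_integral_mass f (C k : R) A B : 0 <= C ->
  measurable_fun setT f -> measurable A -> measurable B ->
  (forall x, 0 <= f x <= C) -> (forall x, f x + k * \1_A x <= \1_B x) ->
  \int[mu]_x (f x) + k * fine (mu A) <= fine (mu B).
Proof.
move=> C0 mf mA mB fC fk.
have e : \int[mu]_x (cst 0 x : R) = 0 by rewrite Rintegral_cst// mul0r.
have : \int[mu]_x (f x) + k * fine (mu A) <= \int[mu]_x (cst 0 x : R) + 0 + 1 * fine (mu B).
  apply: (le_bounded_integral f (cst 0) C) => // x; first by rewrite lexx.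
  by rewrite addr0 add0r mul1r.
by rewrite e addr0 add0r mul1r.
Qed.

End BoundedIntegral.

(** For negative [t], nonnegativity of the half-line second moment gives $(1+t^2)\Phi(t)\ge
    -t\varphi(t)>0$. *)
Lemma Phi_gt0 {R : realType} (t : R) : 0 < Phi t.
Proof.
have [t0|t0] := leP 0 t; first by apply: lt_le_trans (Phi_ge_half _ t0); rewrite invr_gt0.
suff : (0%:E <= ((1 + t ^+ 2) * Phi t + t * phi t)%:E)%E.
  rewrite lee_fin => h; have : 0 < (1 + t ^+ 2) * Phi t.
    by apply: lt_le_trans (_ : - t * phi t <= _); [rewrite mulr_gt0 ?phi_gt0//; lra|lra].
  by rewrite pmulr_rgt0// ltr_pwDl// sqr_ge0.
rewrite -gaussian_moment2; apply: integral_ge0 => x _.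
by rewrite lee_fin mulr_ge0 ?phi_ge0// sqr_ge0.
Qed.

(** * Bounds for a stationary law at a fixed step size *)

Section StationaryBounds.
Context {R : realType}.
Local Notation phi := (@phi R).
Local Notation Phi := (@Phi R).
Variables (sigma gamma c L m R1 : R) (tau : R -> R) (mu : probability R R).
Hypotheses (sigma0 : 0 < sigma) (gamma0 : 0 < gamma) (c0 : 0 <= c) (L0 : 0 <= L)
  (m0 : 0 < m) (R10 : 0 <= R1).
Hypothesis tau_ge0 : forall r, 0 <= r -> 0 <= tau r.
Hypothesis tau_nd : forall r x, 0 <= r -> r <= x -> tau r <= tau x.
Hypothesis tau0 : tau 0 = 0.
Hypothesis tau_le : forall r, 0 < r -> tau r <= (1 + gamma * L) * r.
Hypothesis tau_contr : forall r, R1 < r -> tau r <= (1 - gamma * m) * r.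
Hypothesis mu_inv : invariant_prob sigma c gamma tau mu.

Let s := sigma * Num.sqrt gamma.
(** [Num.max w 0] extends the mean map to the whole line, keeping it monotone and nonnegative; [mu]
    does not charge the negative half-line. *)
Let beta w := tau (Num.max w 0) + gamma * c.
Let lam := 1 + gamma * L.
Let pos : set R := [set x | 0 < x].
Let small : set R := `]0, R1]%classic.

Let s0 : 0 < s. Proof. by rewrite mulr_gt0// sqrtr_gt0. Qed.

Let s2 : 0 < 2 * s. Proof. by rewrite mulr_gt0. Qed.

Let sE : s ^+ 2 = sigma ^+ 2 * gamma.
Proof. by rewrite exprMn sqr_sqrtr// ltW. Qed.

Let gc0 : 0 <= gamma * c. Proof. by rewrite mulr_ge0// ltW. Qed.

Let lam1 : 1 <= lam. Proof. by rewrite lerDl mulr_ge0// ltW. Qed.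

Let lam_gt0 : 0 < lam. Proof. exact: lt_le_trans ltr01 lam1. Qed.

Let max0 (w : R) : 0 <= Num.max w 0. Proof. by rewrite le_max lexx orbT. Qed.

Let mmax : measurable_fun setT (fun w : R => Num.max w 0).
Proof. exact: measurable_maxr. Qed.

Let beta_ge0 w : 0 <= beta w.
Proof. by rewrite addr_ge0// tau_ge0. Qed.

Let mbeta : measurable_fun setT beta.
Proof.
apply: measurable_funD => //; apply: nondecreasing_measurable => // x y xy.
by apply: tau_nd => //; rewrite ge_max !le_max xy lexx !orbT.
Qed.

Let beta_le w : beta w <= lam * Num.max w 0 + gamma * c.
Proof.
rewrite lerD2r; have := max0 w; rewrite le_eqVlt => /orP[/eqP<-|/tau_le//].
by rewrite tau0 mulr0.
Qed.

Let mpos : measurable pos.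
Proof. by rewrite /pos -set_itvoy; exact: measurable_itv. Qed.

Let msmall : measurable small. Proof. exact: measurable_itv. Qed.

Let p := fine (mu pos).
Let q := fine (mu small).

Let pE : mu pos = p%:E.
Proof. by rewrite fineK// fin_num_measure. Qed.

Let qE : mu small = q%:E.
Proof. by rewrite fineK// fin_num_measure. Qed.

Let p0 : 0 <= p. Proof. by rewrite fine_ge0. Qed.
Let q0 : 0 <= q. Proof. by rewrite fine_ge0. Qed.

Let mu_neg : mu [set x | x < 0] = 0%E. Proof. by case: mu_inv. Qed.

Let mneg : measurable [set x : R | x < 0].
Proof. by rewrite -set_itvNyo; exact: measurable_itv. Qed.

Let stationary (f : R -> R) : measurable_fun setT f -> (forall x, 0 <= f x) ->
  (forall x, x <= 0 -> f x = 0) ->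
  (\int[mu]_x (f x)%:E = \int[mu]_w sticky_op s f (beta w))%E.
Proof.
move=> mf f0 fN; apply: (sticky_stationary mu beta s s0 mbeta beta_ge0) => // A mA A0.
have [_ ->//] := mu_inv.
have m1 : measurable_fun setT (fun w => sticky_op s \1_A (beta w)).
  apply: measurable_sticky_op => //; exact: measurable_indic.
(* The invariance equation integrates over [0 <= w] only; the negative half-line is negligible. *)
rewrite [RHS](@ge0_negligible_integral _ _ _ mu setT [set x | x < 0])//; last first.
  move=> w _; apply: integral_ge0 => t; rewrite /= in_itv/= andbT => t0.
  by rewrite lee_fin mulr_ge0 ?sticky_density_ge0// divr_ge0// ltW.
have -> : setT `\` [set x : R | x < 0] = [set w | 0 <= w].
  by apply/seteqP; split => x /=; [case=> _ /negP; rewrite -leNgt|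
    move=> x0; split=> //; apply/negP; rewrite -leNgt].
apply: eq_integral => w; rewrite inE/= => w0.
have bE : beta w = tau w + gamma * c by rewrite /beta max_l.
have b0 : 0 <= tau w + gamma * c by rewrite -bE.
by rewrite bE (Qker_sticky_op sigma c gamma tau w A sigma0 gamma0 b0 mA A0).
Qed.

(** * Iteration along Gaussian distribution functions *)

Let mPhi r (f : R -> R) : measurable_fun setT f ->
  measurable_fun setT (fun w => 2 * Phi (r * f w) - 1).
Proof.
move=> mf; apply: measurable_funB => //; apply: measurable_funM => //.
by apply: (measurableT_comp (measurable_PhiM r)).
Qed.

Let Phi01 r x : 0 <= r -> 0 <= x -> 0 <= 2 * Phi (r * x) - 1 <= 1.
Proof.
move=> r0 x0; have := Phi_ge_half _ (mulr_ge0 r0 x0).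
have := @Phi_le1 R (r * x); move=> a b; apply/andP; split; lra.
Qed.

(** The start of the iteration: stationarity tested on the indicator of the positive half-line. *)
Let mass_pos : p = \int[mu]_w (2 * Phi ((2 * s)^-1 * beta w) - 1).
Proof.
rewrite /p /Rintegral; congr fine; rewrite -[in LHS](setIT pos) -integral_indic//.
rewrite stationary//.
- apply: eq_integral => w _.
  rewrite (eq_sticky_op s s0 _ (cst 1))//.
    by rewrite (sticky_op_cst s s0)// mul1r [beta w / _]mulrC.
  by move=> x x0; rewrite indicE (mem_set (x0 : pos x)).
- by move=> x x0; rewrite indicE memNset// /pos/= => /lt_le_trans/(_ x0); rewrite ltxx.
Qed.

Let U r := \int[mu]_w (2 * Phi (r * Num.max w 0) - 1).

Let U_stationary r : 0 <= r ->
  U r = \int[mu]_w (2 * Phi (r / Num.sqrt (1 + 4 * s ^+ 2 * r ^+ 2) * beta w) - 1).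
Proof.
move=> r0; apply: (congr1 fine).
apply: (etrans (stationary (fun w => 2 * Phi (r * Num.max w 0) - 1) _ _ _)).
- exact: (mPhi r _ mmax).
- by move=> x; have /andP[] := Phi01 r _ r0 (max0 x).
- by move=> x x0; rewrite max_r// mulr0 Phi0; lra.
- apply: eq_integral => w _.
  rewrite (eq_sticky_op s s0 _ (fun x => 2 * Phi (r * x) - 1))//.
    by rewrite (sticky_op_Phi s s0)// mulrAC.
  by move=> x x0; rewrite max_l// ltW.
Qed.

(** The expansion factor [lam] is absorbed into the slope, and the drift is paid for by the
    Lipschitz constant [phi 0]. *)
Let Phi_beta_le r rho : 0 <= r -> r * lam <= rho ->
  \int[mu]_w (2 * Phi (r * beta w) - 1) <= U rho + 2 * (r * (gamma * c)) * phi 0.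
Proof.
move=> r0 rl; have rho0 : 0 <= rho.
  by apply: le_trans rl; rewrite mulr_ge0// ltW.
apply: (le_bounded_integralD mu _ _ 1 _ (mPhi r _ mbeta) (mPhi rho _ mmax)) => w.
- exact: Phi01.
- exact: Phi01.
have h1 : r * beta w <= rho * Num.max w 0 + r * (gamma * c).
  apply: (le_trans (ler_wpM2l r0 (beta_le w))); rewrite mulrDr lerD2r mulrA.
  exact: ler_wpM2r.
have h2 := Phi_nd _ _ h1.
have h3 : rho * Num.max w 0 <= rho * Num.max w 0 + r * (gamma * c).
  by rewrite lerDl mulr_ge0.
have := Phi_lipschitz _ _ h3; rewrite addrAC subrr add0r => h4; lra.
Qed.

(** Without expansion, $r^{-2}$ grows by $4s^2$ at each step, which gives the slope $1/(2s\sqrt k)$;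
    [lam ^+ k] allows for [k] expansions. *)
Let rate k := lam ^+ k / (2 * s * Num.sqrt k%:R).

Let U_step k : (0 < k)%N ->
  U (rate k) <= U (rate k.+1) +
    2 * (lam ^+ k / (2 * s * Num.sqrt k.+1%:R) * (gamma * c)) * phi 0.
Proof.
move=> k0; have lk : 0 < lam ^+ k by rewrite exprn_gt0.
have kr : 0 < Num.sqrt k%:R :> R by rewrite sqrtr_gt0 ltr0n.
have k1r : 0 < Num.sqrt k.+1%:R :> R by rewrite sqrtr_gt0 ltr0n.
have r0 : 0 < rate k by rewrite divr_gt0// mulr_gt0.
rewrite U_stationary ?(ltW r0)//; set r' := rate k / _.
have q1 : 0 < Num.sqrt (1 + 4 * s ^+ 2 * rate k ^+ 2).
  by rewrite sqrtr_gt0 ltr_pwDl// mulr_ge0 ?sqr_ge0// mulr_ge0 ?sqr_ge0.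
have r'le : r' <= lam ^+ k / (2 * s * Num.sqrt k.+1%:R).
  set D := Num.sqrt _ in q1 *; set x := Num.sqrt _ in k1r *.
  (* After squaring this reads $k+1\le k+\lambda^{2k}$, true since [1 <= lam]. *)
  have xD : x <= Num.sqrt k%:R * D.
    rewrite /x /D -sqrtrM ?ler0n// ler_wsqrtr//.
    have -> : rate k ^+ 2 = (lam ^+ k) ^+ 2 / (4 * s ^+ 2 * k%:R).
      by rewrite /rate -[in RHS](sqr_sqrtr (ler0n R k)); field; rewrite !gt_eqF.
    have kn : k%:R != 0 :> R by rewrite pnatr_eq0 -lt0n.
    have -> : k%:R * (1 + 4 * s ^+ 2 * ((lam ^+ k) ^+ 2 / (4 * s ^+ 2 * k%:R))) =
        k%:R + (lam ^+ k) ^+ 2.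
      by field; rewrite kn gt_eqF.
    by rewrite -addn1 natrD lerD2l exprn_ege1// exprn_ege1.
  have -> : r' = lam ^+ k / (2 * s * x) * (x / Num.sqrt k%:R / D).
    rewrite /r' -/D; move: (D) q1 => D' q1; rewrite /rate.
    by field; rewrite !gt_eqF.
  rewrite ler_piMr//; first by rewrite divr_ge0// ltW// mulr_gt0.
  by rewrite ler_pdivrMr// mul1r ler_pdivrMr// mulrC.
set r := lam ^+ k / (2 * s * Num.sqrt k.+1%:R) in r'le *.
have r'0 : 0 <= r' by rewrite divr_ge0// ltW.
apply: (le_trans (Phi_beta_le r' (rate k.+1) r'0 _)).
  apply: (le_trans (ler_wpM2r (ltW lam_gt0) r'le)).
  by rewrite /r /rate exprSr mulrAC.
rewrite lerD2l ler_wpM2r ?phi_ge0// ler_wpM2l// ler_wpM2r//.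
Qed.

Let mass_pos_le_U1 : p <= U (rate 1) + 2 * ((2 * s)^-1 * (gamma * c)) * phi 0.
Proof.
rewrite mass_pos; apply: Phi_beta_le.
  by rewrite invr_ge0 ltW.
by rewrite /rate expr1 sqrtr1 mulr1 mulrC.
Qed.

(** Sums the drift costs [C * lam ^+ k / Num.sqrt k.+1%:R] over the first [n.+1] steps. *)
Let mass_pos_le_U n B : (forall k, (k < n.+1)%N -> lam ^+ k <= B) ->
  p <= U (rate n.+1) +
    2 * Num.sqrt n.+1%:R * (c * phi 0 * Num.sqrt gamma / sigma * B).
Proof.
set C := c * phi 0 * Num.sqrt gamma / sigma.
have C0 : 0 <= C by rewrite /C !mulr_ge0 ?phi_ge0 ?sqrtr_ge0// invr_ge0 ltW.
have sg : Num.sqrt gamma != 0 by rewrite gt_eqF// sqrtr_gt0.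
have g2 : gamma = Num.sqrt gamma ^+ 2 by rewrite sqr_sqrtr// ltW.
have incE k : 2 * (lam ^+ k / (2 * s * Num.sqrt k.+1%:R) * (gamma * c)) * phi 0 =
    C * lam ^+ k / Num.sqrt k.+1%:R.
  have kn : Num.sqrt k.+1%:R != 0 :> R by rewrite gt_eqF// sqrtr_gt0 ltr0n.
  have -> : gamma * c = Num.sqrt gamma ^+ 2 * c by rewrite -g2.
  by rewrite /C /s; field; rewrite kn sg gt_eqF.
elim: n => [|n IH] lB.
  apply: (le_trans mass_pos_le_U1); rewrite lerD2l sqrtr1 mulr1.
  have := incE 0%N; rewrite expr0 sqrtr1 [2 * s * 1]mulr1 div1r => ->.
  have := lB 0%N isT; rewrite expr0 => B1.
  rewrite divr1 mulr1; have := ler_wpM2l C0 B1; rewrite mulr1 => h.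
  apply: (le_trans h); have : 0 <= C * B by apply: le_trans h.
  lra.
apply: (le_trans (IH (fun k kn => lB k (ltnW kn)))).
apply: (le_trans (lerD (U_step n.+1 isT) (lexx _))); rewrite incE.
rewrite -addrA lerD2l.
have B0 : 0 <= B by apply: le_trans (lB 0%N isT); rewrite expr0.
have h1 := ler_wpM2l C0 (lB n.+1 (leqnn _)).
set x := Num.sqrt n.+2%:R; set y := Num.sqrt n.+1%:R.
have x0 : 0 < x by rewrite sqrtr_gt0 ltr0n.
have y0 : 0 < y by rewrite sqrtr_gt0 ltr0n.
have xy : x ^+ 2 = y ^+ 2 + 1.
  by rewrite !sqr_sqrtr ?ler0n// -[n.+2]addn1 natrD.
(* Telescoping bound $1/\sqrt{n+2}\le2(\sqrt{n+2}-\sqrt{n+1})$. *)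
have h2 : x^-1 <= 2 * x - 2 * y.
  by rewrite -[leLHS]div1r ler_pdivrMr//; have := sqr_ge0 (x - y); nra.
have CB : 0 <= C * B by rewrite mulr_ge0.
have h3 := ler_wpM2l CB h2.
have h4 : C * lam ^+ n.+1 / x <= C * B / x by rewrite ler_wpM2r// invr_ge0 ltW.
lra.
Qed.

(** On []0, R1]] the indicator of the positive half-line exceeds [2 * Phi (r * w) - 1] by at least
    [2 * Phi (- (R1 * r))]. Integrating bounds [p] from below, and [U r] cancels against the upper
    bound. *)
Lemma small_mass_le n B : (forall k, (k < n.+1)%N -> lam ^+ k <= B) ->
  fine (mu `]0, R1]%classic) *
    Phi (- (R1 * (lam ^+ n.+1 / (2 * s * Num.sqrt n.+1%:R)))) <=
  c * phi 0 * Num.sqrt (n.+1%:R * gamma) / sigma * B.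
Proof.
move=> lB; have := mass_pos_le_U n B lB; rewrite -/small -/q -/(rate n.+1).
have r0 : 0 <= rate n.+1.
  apply: divr_ge0; first by rewrite exprn_ge0// ltW.
  by rewrite mulr_ge0 ?sqrtr_ge0// ltW.
move: (rate _) r0 => r r0.
have h : U r + 2 * Phi (- (R1 * r)) * q <= p.
  apply: (le_bounded_integral_mass mu _ 1 _ _ _ ler01 (mPhi r _ mmax)) => // w.
    exact: Phi01.
  rewrite !indicE.
  have [w0|w0] := leP w 0.
    rewrite mulr0 Phi0 memNset; last first.
      by rewrite /small/= in_itv/= ltNge w0.
    by rewrite mulr0 addr0 divff// subrr ler0n.
  rewrite [w \in pos]mem_set//.
  have P1 := @Phi_le1 R (r * w).
  have [wR|wR] := leP w R1.
    rewrite mem_set; last by rewrite /small/= in_itv/= w0.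
    have : Phi (- (R1 * r)) <= Phi (- (r * w)).
      by rewrite Phi_nd// lerN2 mulrC ler_wpM2r.
    rewrite [Phi (- (r * w))]PhiN (_ : true%:R = 1 :> R)// => P2; lra.
  rewrite memNset; last by rewrite /small/= in_itv/= w0/= leNgt wR.
  rewrite (_ : true%:R = 1 :> R)// (_ : false%:R = 0 :> R)//; lra.
move=> h2; have := le_trans h h2.
rewrite -lerBrDl addrAC subrr add0r sqrtrM ?ler0n// => h3.
rewrite mulrC.
have -> : c * phi 0 * (Num.sqrt n.+1%:R * Num.sqrt gamma) / sigma * B =
  Num.sqrt n.+1%:R * (c * phi 0 * Num.sqrt gamma / sigma * B) by ring.
by lra.
Qed.

(** * The stationary mean *)

Lemma mean_stationary :
  (\int[mu]_w (Num.max w 0)%:E = \int[mu]_w (beta w)%:E)%E.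
Proof.
apply: (etrans (stationary (fun w => Num.max w 0) _ _ _)) => //.
- by move=> x x0; rewrite max_r.
- apply: eq_integral => w _; rewrite (eq_sticky_op s s0 _ id)//.
    by rewrite (sticky_op_id s s0).
  by move=> x x0; rewrite max_l// ltW.
Qed.

(** Balances the inward drift beyond [R1] against the outward one. The mean is not yet known to be
    finite, so the argument is run on functions truncated at [N]. *)
Let large_mean_le (N : R) : R1 <= N -> 0 < N ->
  m * (\int[mu]_w (w * \1_(`]R1, N]%classic : set R) w)) <= c + L * R1 * q.
Proof.
move=> RN N0; set g := fun w : R => w * \1_(`]R1, N]%classic : set R) w.
have gN w : 0 <= g w <= N.
  rewrite /g indicE mem_setE in_itv/=; case: (boolP (R1 < w <= N)) => [/andP[Rw wN]|_].
    by rewrite mulr1 wN andbT (le_trans R10)// ltW.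
  by rewrite mulr0 lexx ltW.
have mg : measurable_fun setT g by apply: measurable_funM => //; exact: measurable_indic.
have mW : measurable_fun setT (fun w : R => Num.min (Num.max w 0) N).
  exact: measurable_minr.
have mB : measurable_fun setT (fun w : R => Num.min (beta w) N).
  exact: measurable_minr.
have itv x : 0 <= x -> 0 <= Num.min x N <= N.
  by move=> x0; rewrite le_min x0 (ltW N0) ge_min lexx orbT.
(* Stationarity followed by Jensen for the concave function [Num.min x N]. *)
have h1 : \int[mu]_w (Num.min (Num.max w 0) N) <= \int[mu]_w (Num.min (beta w) N).
  rewrite -lee_fin (EFin_bounded_integral mu _ N mW); last by move=> x; exact: itv.
  rewrite (EFin_bounded_integral mu _ N mB); last by move=> x; exact: itv.
  rewrite (stationary (fun w => Num.min (Num.max w 0) N) mW); first last.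
  - by move=> x x0; rewrite max_r// min_l// ltW.
  - by move=> x; have /andP[] := itv _ (max0 x).
  apply: ge0_le_integral => //.
  - move=> w _; apply: integral_ge0 => t; rewrite /= in_itv/= andbT => t0.
    rewrite lee_fin mulr_ge0 ?sticky_density_ge0//.
      by have /andP[] := itv _ (max0 (2 * s * t)).
    by rewrite divr_ge0// ltW.
  - apply: measurable_sticky_op => // x; by have /andP[] := itv _ (max0 x).
  - by apply/measurable_EFinP.
  - move=> w _; rewrite (eq_sticky_op s s0 _ (fun x => Num.min x N))//.
      by apply: sticky_op_min_le => //; exact: ltW.
    by move=> x x0; rewrite max_l// ltW.
have gm0 : 0 <= gamma * m by rewrite mulr_ge0// ltW.
have iB := integrable_bounded mu _ N mB (fun w => itv _ (beta_ge0 w)).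
have ig := integrable_bounded mu _ N mg gN.
have mk : measurable_fun setT (fun w => gamma * m * g w) by exact: measurable_funM.
have kN w : 0 <= gamma * m * g w <= gamma * m * N.
  by have /andP[a b] := gN w; rewrite mulr_ge0//= ler_wpM2l.
have ik := integrable_bounded mu _ _ mk kN.
have e : \int[mu]_w (Num.min (beta w) N + gamma * m * g w) =
    \int[mu]_w (Num.min (beta w) N) + gamma * m * \int[mu]_w (g w).
  by rewrite RintegralD// RintegralZl.
have : \int[mu]_w (Num.min (beta w) N + gamma * m * g w) + 0 * fine (mu pos) <=
    \int[mu]_w (Num.min (Num.max w 0) N) + gamma * c + (gamma * L * R1) * fine (mu small).
  apply: (le_bounded_integral mu _ _ (N + gamma * m * N)) => //.
  - exact: measurable_funD.
  - move=> w; have /andP[a1 a2] := itv _ (beta_ge0 w); have /andP[b1 b2] := kN w.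
    by rewrite addr_ge0//= lerD.
  - move=> w; have /andP[a1 a2] := itv _ (max0 w); rewrite a1 (le_trans a2)// lerDl.
    by rewrite mulr_ge0// ltW.
  - move=> w; rewrite mul0r addr0 /g !indicE !mem_setE !in_itv/=.
    have bw := beta_le w; have NN := ltW N0.
    have [w0|w0] := leP w 0.
      rewrite ltNge (le_trans w0 R10)/= !mulr0 !addr0 [Num.min 0 N]min_l// ge_min.
      by rewrite max_r// mulr0 add0r in bw; rewrite add0r bw.
    have wE : Num.max w 0 = w by rewrite max_l// ltW.
    rewrite wE in bw.
    have [wR|wR] := leP w R1.
      rewrite /= mulr0 mulr0 addr0 mulr1.
      have d0 : gamma * L * w <= gamma * L * R1 by rewrite ler_wpM2l// mulr_ge0// ltW.
      have wN := le_trans wR RN; rewrite [Num.min w N]min_l//.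
      rewrite ge_min; apply/orP; left; apply: (le_trans bw); rewrite /lam; lra.
    have [wN|wN] := leP w N; rewrite /= ?andbF ?mulr1 !mulr0 !addr0.
      have bE : beta w <= (1 - gamma * m) * w + gamma * c.
        by rewrite /beta wE lerD2r tau_contr.
      apply: (@le_trans _ _ (beta w + gamma * m * w)).
        by rewrite lerD2r ge_min lexx.
      lra.
    by rewrite ge_min; apply/orP; right; rewrite lerDl.
rewrite e -/q => h2; have h3 : gamma * (m * \int[mu]_w (g w)) <= gamma * (c + L * R1 * q) by lra.
by move: h3; rewrite ler_pM2l.
Qed.

(** Points of []0, R1]] contribute at most [R1 * q] and larger ones are covered by [large_mean_le];
    the bound is uniform in the truncation, so monotone convergence applies. *)
Lemma mean_le : (\int[mu]_w (Num.max w 0)%:E <=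
  (R1 * (1 + L / m) * fine (mu `]0, R1]%classic) + c / m)%:E)%E.
Proof.
rewrite -/small -/q; set K := _ + c / m.
pose f n (w : R) : R := Num.max w 0 * \1_(`]-oo, n%:R]%classic : set R) w.
have f0 n w : 0 <= f n w by rewrite mulr_ge0.
have mf n : measurable_fun setT (f n).
  by apply: measurable_funM => //; exact: measurable_indic.
have fK n : (\int[mu]_w (f n w)%:E <= K%:E)%E.
  (* [n.+1] rather than [n] keeps [N] positive at [n = 0]. *)
  pose N := Num.max n.+1%:R R1.
  have N0 : 0 < N by rewrite lt_max ltr0n.
  have RN : R1 <= N by rewrite le_max lexx orbT.
  have nN : n%:R <= N by rewrite le_max ler_nat leqnSn.
  set g := fun w : R => w * \1_(`]R1, N]%classic : set R) w.
  have gN w : 0 <= g w <= N.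
    rewrite /g indicE mem_setE in_itv/=; case: (boolP (R1 < w <= N)) => [/andP[Rw wN]|_].
      by rewrite mulr1 wN andbT (le_trans R10)// ltW.
    by rewrite mulr0 lexx ltW.
  have mg : measurable_fun setT g by apply: measurable_funM => //; exact: measurable_indic.
  have fN w : 0 <= f n w <= N.
    rewrite f0/= /f indicE mem_setE in_itv/=; case: (leP w n%:R) => wn.
      by rewrite mulr1 ge_max (le_trans wn nN) ltW.
    by rewrite mulr0 ltW.
  rewrite -(EFin_bounded_integral mu _ N (mf n) fN) lee_fin.
  have : \int[mu]_w (f n w) + 0 * fine (mu pos) <=
      \int[mu]_w (g w) + 0 + R1 * fine (mu small).
    apply: (le_bounded_integral mu _ _ N) => // w.
    rewrite mul0r !addr0 /f /g !indicE !mem_setE !in_itv/=.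
    have [w0|w0] := leP w 0.
      by rewrite mul0r ltNge (le_trans w0 R10)/= !mulr0 addr0.
    have [wR|wR] := leP w R1.
      rewrite /= mulr0 add0r mulr1.
      by case: (w <= n%:R); rewrite ?mulr1// mulr0.
    rewrite /= mulr0 addr0; case: (leP w n%:R) => wn /=; last first.
      by rewrite mulr0 mulr_ge0// ltW.
    by rewrite (le_trans wn nN).
  have := large_mean_le N RN N0; rewrite -/g -/q => hm hf.
  have hg : \int[mu]_w (g w) <= (c + L * R1 * q) / m by rewrite ler_pdivlMr// mulrC.
  rewrite /K (_ : _ + c / m = (c + L * R1 * q) / m + R1 * q); last first.
    by field; rewrite gt_eqF.
  by move: hf; rewrite mul0r !addr0 => hf; apply: (le_trans hf); rewrite lerD2r.
have : (\int[mu]_w (f n w)%:E @[n --> \oo] --> \int[mu]_w (Num.max w 0)%:E)%E.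
  have fE w : (f n w)%:E @[n --> \oo] --> (Num.max w 0)%:E.
    apply: cvg_near_cst; near=> n; rewrite /f indicE mem_set ?mulr1//=.
    by rewrite in_itv/=; near: n; exact: nbhs_infty_ger.
  rewrite (_ : (fun w => (Num.max w 0)%:E) = (fun w => limn (fun n => (f n w)%:E))); last first.
    by apply/funext => w; apply/esym/cvg_lim => //; exact: fE.
  apply: cvg_monotone_convergence => //.
  - by move=> n; apply/measurable_EFinP; exact: mf.
  - by move=> n w _; rewrite lee_fin.
  - move=> w _ i j ij; rewrite lee_fin ler_wpM2l// !indicE !mem_setE !in_itv/= ler_nat.
    case: (leP w i%:R) => // wi; rewrite (le_trans wi)// ler_nat//.
move=> h; apply: (cvge_le _ h) => //.
by near=> n; exact: fK.
Unshelve. all: end_near. Qed.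

(** Stationarity on the truncated cubic: the concavity gain is proportional to [p], the cost to [M],
    and the drift enters through the tangent bound. Finiteness of the mean permits the
    cancellations. *)
Lemma pos_mass_le (M A : R) : 0 < A -> (\int[mu]_w (Num.max w 0)%:E = M%:E)%E ->
  fine (mu [set x : R | 0 < x]) * (1 - L * A ^+ 2 / (16 * sigma ^+ 2)) <=
  M / A + c * A / (4 * sigma ^+ 2).
Proof.
move=> A0 ME; rewrite -/pos -/p.
have mc := measurable_cubic_cap A.
have mF : measurable_fun setT (fun w : R => cubic_cap A (Num.max w 0)).
  exact: measurableT_comp.
have mb : measurable_fun setT (fun w : R => cubic_cap A (beta w)).
  exact: measurableT_comp.
have itv x : 0 <= x -> 0 <= cubic_cap A x <= A ^+ 3 by exact: cubic_cap_itv.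
pose k := 12 * A * s ^+ 2; have k0 : 0 <= k.
  by rewrite /k mulr_ge0 ?sqr_ge0// mulr_ge0// ltW.
pose F (w : R) : R := cubic_cap A (Num.max w 0).
have F0 w : 0 <= F w by have /andP[] := itv _ (max0 w).
have st : (\int[mu]_w (F w)%:E = \int[mu]_w sticky_op s F (beta w))%E.
  apply: (stationary F mF F0) => x x0.
  by rewrite /F max_r// /cubic_cap subr0 max_r ?subrr// ltW.
have Pw w : 0 <= 2 * Phi ((2 * s)^-1 * beta w) - 1 <= 1.
  by apply: Phi01 => //; rewrite invr_ge0 ltW.
have mP := mPhi (2 * s)^-1 _ mbeta.
have st0 w : (0 <= sticky_op s F (beta w))%E.
  apply: integral_ge0 => t; rewrite /= in_itv/= andbT => t0.
  by rewrite lee_fin mulr_ge0 ?sticky_density_ge0// divr_ge0// ltW.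
have stm : measurable_fun setT (fun w => sticky_op s F (beta w)).
  exact: (measurable_sticky_op beta s s0 mbeta beta_ge0 F mF F0).
have mPE : measurable_fun setT (fun w => (2 * Phi ((2 * s)^-1 * beta w) - 1)%:E).
  exact/measurable_EFinP.
have P0 w : (0 <= (2 * Phi ((2 * s)^-1 * beta w) - 1)%:E)%E.
  by rewrite lee_fin; have /andP[] := Pw w.
have kP w : (0 <= k%:E * (2 * Phi ((2 * s)^-1 * beta w) - 1)%:E)%E.
  by rewrite mule_ge0// lee_fin.
have mkP : measurable_fun setT (fun w => k%:E * (2 * Phi ((2 * s)^-1 * beta w) - 1)%:E)%E.
  exact: measurable_funeM.
have s12 : 0 <= 12 * s ^+ 2 by rewrite mulr_ge0// sqr_ge0.
have bE0 w : (0 <= (beta w)%:E)%E by rewrite lee_fin.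
have mbE : measurable_fun setT (EFin \o beta) by exact/measurable_EFinP.
(* [mass_pos] turns the averaged gain into [k * p], and [mean_stationary] turns the average of
   [beta] into [M]. *)
have h : (\int[mu]_w (F w)%:E + k%:E * p%:E <=
    \int[mu]_w (cubic_cap A (beta w))%:E + (12 * s ^+ 2)%:E * M%:E)%E.
  rewrite -ME mean_stationary mass_pos (EFin_bounded_integral mu _ 1 mP Pw) st.
  rewrite -ge0_integralZl//= -ge0_integralZl//= -ge0_integralD//=.
  - rewrite -ge0_integralD//=.
    + apply: ge0_le_integral => //=.
      * by move=> w _; rewrite adde_ge0.
      * exact: emeasurable_funD.
      * apply: emeasurable_funD; first exact/measurable_EFinP.
        exact: measurable_funeM.
      * move=> w _; rewrite (eq_sticky_op s s0 F (cubic_cap A))//.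
          have := sticky_op_cubic_cap s s0 A (beta w) A0 (beta_ge0 w).
          by rewrite /k EFinD !EFinM [beta w / _]mulrC.
        by move=> x x0; rewrite /F max_l// ltW.
    + by move=> w _; rewrite lee_fin; have /andP[] := itv _ (beta_ge0 w).
    + exact/measurable_EFinP.
    + by move=> w _; rewrite mule_ge0// lee_fin.
    + exact: measurable_funeM.
have Fi w : 0 <= F w <= A ^+ 3 by exact: itv.
have bi w : 0 <= cubic_cap A (beta w) <= A ^+ 3 by exact: itv.
rewrite -(EFin_bounded_integral mu _ _ mF Fi) in h.
rewrite -(EFin_bounded_integral mu _ _ mb bi) -!EFinM -!EFinD lee_fin in h.
have : \int[mu]_w (cubic_cap A (beta w)) + 0 * fine (mu pos) <=
    \int[mu]_w (F w) + 3 * A ^+ 2 * (gamma * c) + (3 / 4 * (gamma * L) * A ^+ 3) * fine (mu pos).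
  apply: (le_bounded_integral mu _ _ (A ^+ 3)) => // w.
  rewrite mul0r addr0; set x := Num.max w 0.
  have gL0 : 0 <= gamma * L by rewrite mulr_ge0// ltW.
  have x0 : 0 <= x by exact: max0.
  have d0 : 0 <= gamma * L * x + gamma * c by rewrite addr_ge0// mulr_ge0.
  have lE : lam * x + gamma * c = x + (gamma * L * x + gamma * c) by rewrite /lam; ring.
  apply: (le_trans (cubic_cap_nd A _ _ (beta_le w))); rewrite -/x lE.
  apply: (le_trans (cubic_cap_shift A x _ d0)); rewrite /F -/x -[leRHS]addrA lerD2l.
  set t := Num.max 0 (A - x).
  have t0 : 0 <= t by rewrite le_max lexx.
  have tA : t <= A by rewrite ge_max (ltW A0)/= gerBl.
  have t2A : t ^+ 2 <= A ^+ 2 by rewrite ler_pXn2r// nnegrE// ltW.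
  have h1 : t ^+ 2 * (gamma * c) <= A ^+ 2 * (gamma * c) by rewrite ler_wpM2r.
  rewrite indicE; have [w0|w0] := leP w 0.
    have xE : x = 0 by rewrite /x max_r.
    have np : ~ pos w by rewrite /pos/= => /lt_le_trans/(_ w0); rewrite ltxx.
    by rewrite (memNset np) mulr0 addr0 xE mulr0 add0r; lra.
  rewrite mem_set// mulr1.
  (* $x(A-x)\le A^2/4$; with [t <= A] this bounds the expansion part of the tangent term by a
     multiple of $A^3$ on the positive half-line. *)
  have tx : t * x <= A ^+ 2 / 4.
    have : t * x <= (A - x) * x \/ t = 0.
      by rewrite /t; case: (leP 0 (A - x)) => ?; [left|right].
    have : 0 <= (A / 2 - x) ^+ 2 by exact: sqr_ge0.
    have : 0 <= A ^+ 2 by exact: sqr_ge0.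
    by move=> ? ? [?|->]; [|rewrite mul0r]; lra.
  have tx3 : t ^+ 2 * x <= A ^+ 3 / 4.
    rewrite expr2 -mulrA; apply: (le_trans (ler_wpM2l t0 tx)).
    have A20 : 0 <= A ^+ 2 / 4 by rewrite divr_ge0// sqr_ge0.
    by apply: (le_trans (ler_wpM2r A20 tA)); rewrite exprS mulrA.
  have h2 := ler_wpM2l gL0 tx3.
  lra.
rewrite -/p mul0r addr0 => h2.
have e : 12 * A * sigma ^+ 2 * gamma * p <= 12 * sigma ^+ 2 * gamma * M +
    3 * A ^+ 2 * (gamma * c) + 3 / 4 * (gamma * L) * A ^+ 3 * p.
  by rewrite /k sE in h; lra.
have K0 : 0 < 12 * A * sigma ^+ 2 * gamma.
  by rewrite mulr_gt0// mulr_gt0 ?exprn_gt0// mulr_gt0.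
rewrite -(ler_pM2l K0).
have -> : 12 * A * sigma ^+ 2 * gamma * (M / A + c * A / (4 * sigma ^+ 2)) =
  12 * sigma ^+ 2 * gamma * M + 3 * A ^+ 2 * (gamma * c).
  by field; rewrite !gt_eqF.
have -> : 12 * A * sigma ^+ 2 * gamma * (p * (1 - L * A ^+ 2 / (16 * sigma ^+ 2))) =
  12 * A * sigma ^+ 2 * gamma * p - 3 / 4 * (gamma * L) * A ^+ 3 * p.
  by field; rewrite !gt_eqF.
lra.
Qed.

End StationaryBounds.

(** * Comparison of the stationary bounds with the explicit constants *)

Theorem theorem11 (R : realType) (sigma gbar cinf R1 L m : R)
  (tau : R -> R -> R)
  (hsigma : 0 < sigma) (hgbar : 0 < gbar) (hcinf : 0 <= cinf)
  (hR1 : 0 <= R1) (hL : 0 <= L) (hm : 0 < m)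
  (htau_nonneg : forall g r, 0 < g <= gbar -> 0 <= r -> 0 <= tau g r)
  (htau_mono : forall g r s, 0 < g <= gbar -> 0 <= r -> r <= s -> tau g r <= tau g s)
  (htau0 : forall g, 0 < g <= gbar -> tau g 0 = 0)
  (htauL : forall g r, 0 < g <= gbar -> 0 < r -> tau g r / r <= 1 + g * L)
  (htaum : forall g r, 0 < g <= gbar -> R1 < r -> tau g r / r <= 1 - g * m)
  (dbar gamma : R)
  (hdbar0 : 0 < dbar)
  (hdbarL : 0 < L -> dbar <= L^-1)
  (hdbarc : 0 < cinf -> dbar <= (sigma * expR (-1) / cinf) ^+ 2)
  (hgamma : 0 < gamma <= gbar)
  (mu : probability R R)
  (hmu : invariant_prob sigma cinf gamma (tau gamma) mu)
  (hmu_unique : forall nu : probability R R,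
      invariant_prob sigma cinf gamma (tau gamma) nu ->
      forall A : set R, measurable A -> nu A = mu A) :
  (\int[mu]_(w in [set w : R | (0 <= w)%R]) w%:E <= (cinf * c1 sigma gbar cinf R1 L m dbar)%:E)%E /\
  (mu [set w : R | (0 < w)%R] <= (cinf * c2 sigma gbar cinf R1 L m dbar)%:E)%E.
Proof.
have /andP[gamma0 gammale] := hgamma.
pose t := tau gamma.
have tau_ge0 r : 0 <= r -> 0 <= t r by exact: htau_nonneg.
have tau_nd r x : 0 <= r -> r <= x -> t r <= t x by exact: htau_mono.
have tau0 : t 0 = 0 by exact: htau0.
have tau_le r : 0 < r -> t r <= (1 + gamma * L) * r.
  by move=> r0; rewrite -ler_pdivrMr//; exact: htauL.
have tau_contr r : R1 < r -> t r <= (1 - gamma * m) * r.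
  by move=> rR; rewrite -ler_pdivrMr ?(le_lt_trans hR1)//; exact: htaum.
set S := sup [set x ^+ 2 * Phi (- x) | x in [set x : R | 0 <= x]].
have hS : pi / 2 <= 5 / 4 + 2 * S by exact: sup_sqr_Phi_pi.
have p3 := @pi_ge3 R; have p4 := @pi_le316 R.
set r := Num.sqrt (2 * pi : R).
have r0 : 0 < r by exact: sqrt2pi_gt0.
have r2 : r ^+ 2 = 2 * pi by rewrite sqr_sqrtr// mulr_ge0// pi_ge0.
have phi0r : phi (0 : R) = r^-1 by exact: phi0.
pose Lam := dbar + gbar.
have Lam0 : 0 < Lam by exact: addr_gt0.
pose E1 := expR (Lam * L); pose E3 := expR (3 * Lam * L).
have LL0 : 0 <= Lam * L by rewrite mulr_ge0// ltW.
have E11 : 1 + Lam * L <= E1 by exact: expR_ge1Dx.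
have E13 : E1 <= E3 by rewrite ler_expR; lra.
have E10 : 0 < E1 by exact: expR_gt0.
pose G := 1 + gbar * L.
have G1 : 1 <= G by rewrite lerDl mulr_ge0// ltW.
have G2 : 1 <= G ^+ 2 by rewrite exprn_ege1.
have S18 : 1 <= 2 * S + 3 / 4 by lra.
have S0 : 0 <= 2 * S + 1 / 4 by lra.
have rs0 : 0 < r * sigma by exact: mulr_gt0.
(* The inequality only discards [1 <= G ^+ 2] and [E1 <= E3]. *)
have zetaE : (2 * S + 1 / 4) * E1 / (r * sigma) <= 2 * zeta sigma gbar L * E3 / sigma ^+ 3.
  have -> : 2 * zeta sigma gbar L * E3 / sigma ^+ 3 =
      (2 * S + 1 / 4) * (G ^+ 2 * E3) / (r * sigma).
    by rewrite /zeta -/S -/r -/G; field; rewrite !gt_eqF.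
  rewrite ler_pM2r ?invr_gt0// ler_wpM2l//; apply: (le_trans E13).
  by rewrite ler_peMl// expR_ge0.
have sL0 : 0 < Num.sqrt Lam by rewrite sqrtr_gt0.
have sd0 : 0 < Num.sqrt dbar by rewrite sqrtr_gt0.
have sdL : Num.sqrt dbar <= Num.sqrt Lam by rewrite ler_wsqrtr// lerDl ltW.
set Y := (G * R1 + Lam * cinf) / (2 * Num.sqrt dbar * sigma * expR (- (Lam * L))).
have etaE : eta1 sigma gbar cinf R1 L dbar = Num.sqrt Lam *
  (2 * zeta sigma gbar L * E3 / sigma ^+ 3 + E1 / (2 * r * sigma)) / Phi (- Y) by [].
have PY : 0 < Phi (- Y) by exact: Phi_gt0.
have q_le : fine (mu `]0, R1]%classic) <= cinf * eta1 sigma gbar cinf R1 L dbar.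
  (* [n] is the integer part of [dbar / gamma]; the iteration takes [n.+1] steps, whose total length
     lies strictly above [dbar] and at most at [dbar + gbar]. *)
  have /andP[nle nlt] : _ := truncn_itv (divr_ge0 (ltW hdbar0) (ltW gamma0)).
  move: (Num.truncn _) nle nlt => n; rewrite ler_pdivlMr// ltr_pdivrMr// => nle nlt.
  have lam1 : 1 <= 1 + gamma * L by rewrite lerDl mulr_ge0// ltW.
  have lamk k : (1 + gamma * L) ^+ k <= expR (k%:R * gamma * L).
    rewrite -mulrA expRM_natl; apply: lerXn2r; rewrite ?nnegrE ?expR_ge0 ?expR_ge1Dx//.
    exact: le_trans lam1.
  have lB k : (k < n.+1)%N -> (1 + gamma * L) ^+ k <= E1.
    rewrite ltnS => kn; apply: (le_trans (lamk k)); rewrite ler_expR ler_wpM2r//.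
    apply: (@le_trans _ _ (n%:R * gamma)); first by rewrite ler_wpM2r ?ler_nat// ltW.
    by apply: (le_trans nle); rewrite lerDl ltW.
  have n1L : n.+1%:R * gamma <= Lam.
    rewrite -[n.+1]addn1 natrD mulrDl mul1r; exact: lerD.
  have := small_mass_le sigma gamma cinf L R1 t mu hsigma gamma0 hcinf hL tau_ge0 tau_nd
    tau0 tau_le hmu n E1 lB.
  set q := fine _; have q0 : 0 <= q by rewrite fine_ge0.
  set rho := _ / (2 * _ * _) => hq.
  (* The denominator uses the lower bound [dbar] on the total length, the power of [1 + gamma * L]
     the upper bound [Lam]. *)
  have rhoY : R1 * rho <= Y.
    have rhoE : rho <= E1 / (2 * Num.sqrt dbar * sigma).
      have -> : rho = (1 + gamma * L) ^+ n.+1 / (2 * Num.sqrt (n.+1%:R * gamma) * sigma).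
        by rewrite /rho sqrtrM ?ler0n//; congr (_ / _); ring.
      have sn : Num.sqrt dbar <= Num.sqrt (n.+1%:R * gamma) by rewrite ler_wsqrtr// ltW.
      apply: ler_pM.
      - by rewrite exprn_ge0// (le_trans _ lam1).
      - by rewrite invr_ge0 mulr_ge0 ?(ltW hsigma)// mulr_ge0// sqrtr_ge0.
      - by apply: (le_trans (lamk _)); rewrite ler_expR ler_wpM2r.
      - rewrite lef_pV2 ?posrE ?mulr_gt0//; last exact: lt_le_trans sn.
        by rewrite ler_pM2r// ler_pM2l.
    apply: (le_trans (ler_wpM2l hR1 rhoE)).
    have -> : Y = (G * R1 + Lam * cinf) * (E1 / (2 * Num.sqrt dbar * sigma)).
      by rewrite /Y expRN -/E1; field; rewrite !gt_eqF.
    rewrite ler_wpM2r//; first by rewrite divr_ge0 ?(ltW E10)// ltW// !mulr_gt0.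
    apply: (@le_trans _ _ (G * R1)); first by rewrite ler_peMl.
    by rewrite lerDl mulr_ge0// ltW.
  rewrite etaE mulrA ler_pdivlMr//.
  have h1 : q * Phi (- Y) <= q * Phi (- (R1 * rho)).
    by rewrite ler_wpM2l// Phi_nd// lerN2.
  apply: (le_trans h1); apply: (le_trans hq); rewrite phi0r.
  have -> : cinf * r^-1 * Num.sqrt (n.+1%:R * gamma) / sigma * E1 =
     cinf * (Num.sqrt (n.+1%:R * gamma) * (E1 / (r * sigma))).
    by field; rewrite !gt_eqF.
  rewrite ler_wpM2l//; apply: ler_pM.
  - exact: sqrtr_ge0.
  - by rewrite divr_ge0// ltW.
  - exact: ler_wsqrtr.
  have : 1 * (E1 / (r * sigma)) <= (2 * S + 3 / 4) * (E1 / (r * sigma)).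
    by rewrite ler_wpM2r// divr_ge0// ltW.
  have -> : E1 / (2 * r * sigma) = 1 / 2 * (E1 / (r * sigma)) by field; rewrite !gt_eqF.
  lra.
have eta0 : 0 <= eta1 sigma gbar cinf R1 L dbar.
  rewrite etaE mulr_ge0 ?invr_ge0 ?Phi_ge0// mulr_ge0 ?sqrtr_ge0// addr_ge0//.
    by apply: le_trans zetaE; rewrite divr_ge0 ?mulr_ge0// ltW.
  by rewrite divr_ge0 ?(ltW E10)// ltW// !mulr_gt0.
set C1 := c1 sigma gbar cinf R1 L m dbar.
have C10 : 0 <= C1.
  have Lm : 0 <= L / m by rewrite divr_ge0// ltW.
  have m1 : 0 <= 1 / m by rewrite divr_ge0// ltW.
  by apply: addr_ge0 => //; apply: mulr_ge0; [exact: mulr_ge0|exact: addr_ge0].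
have mean_c1 : (\int[mu]_w (Num.max w 0)%:E <= (cinf * C1)%:E)%E.
  apply: (le_trans (mean_le sigma gamma cinf L m R1 t mu hsigma gamma0 hcinf hL hm hR1
    tau_ge0 tau_nd tau0 tau_le tau_contr hmu)).
  rewrite lee_fin /C1 /c1.
  have k0 : 0 <= R1 * (1 + L / m) by rewrite mulr_ge0// addr_ge0// divr_ge0// ltW.
  have := ler_wpM2l k0 q_le; lra.
have mean0 : (0 <= \int[mu]_w (Num.max w 0)%:E)%E.
  by apply: integral_ge0 => w _; rewrite lee_fin le_max lexx orbT.
split.
  rewrite integral_mkcond; apply: le_trans mean_c1; rewrite le_eqVlt; apply/orP; left.
  apply/eqP/eq_integral => w _; rewrite /patch; case: ifPn.
    by rewrite inE/= => w0; rewrite max_l.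
  by rewrite notin_setE/= => /negP; rewrite -ltNge => w0; rewrite max_r// ltW.
have mean_fin : (\int[mu]_w (Num.max w 0)%:E)%E \is a fin_num.
  by rewrite ge0_fin_numE// (le_lt_trans mean_c1)// ltry.
pose M := fine (\int[mu]_w (Num.max w 0)%:E)%E.
have ME : (\int[mu]_w (Num.max w 0)%:E = M%:E)%E by rewrite fineK.
have MC : M <= cinf * C1 by rewrite -lee_fin -ME.
(* This truncation level makes [M / A] match the first summand of [c2] and turns the drift term into
   [pi / 2] times its second summand. *)
have A0 : 0 < r * sigma * Num.sqrt dbar by rewrite mulr_gt0.
have := pos_mass_le sigma gamma cinf L t mu hsigma gamma0 hcinf hL tau_ge0 tau_nd
  tau0 tau_le hmu M _ A0 ME.
set p := fine _; have p0 : 0 <= p by rewrite /p fine_ge0.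
have -> : mu [set x : R | 0 < x] = p%:E.
  have mp : measurable [set x : R | 0 < x] by rewrite -set_itvoy; exact: measurable_itv.
  by rewrite /p fineK// fin_num_measure.
rewrite lee_fin.
have sd2 : Num.sqrt dbar ^+ 2 = dbar by rewrite sqr_sqrtr// ltW.
have -> : L * (r * sigma * Num.sqrt dbar) ^+ 2 / (16 * sigma ^+ 2) = L * dbar * (pi / 8).
  by rewrite !exprMn r2 sd2; field; rewrite gt_eqF.
have -> : M / (r * sigma * Num.sqrt dbar) +
    cinf * (r * sigma * Num.sqrt dbar) / (4 * sigma ^+ 2) =
    (M / Num.sqrt dbar + cinf * (pi / 2 * Num.sqrt dbar)) / (r * sigma).
  have -> : pi = r ^+ 2 / 2 :> R by rewrite r2; field.
  by field; rewrite !gt_eqF.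
set Z := (M / _ + _) / _ => hp.
pose u := L * dbar; rewrite -/u in hp.
have u0 : 0 <= u by rewrite mulr_ge0// ltW.
have u1 : u <= 1.
  move: hL; rewrite le_eqVlt => /orP[/eqP L0|Lp]; first by rewrite /u -L0 mul0r.
  by rewrite /u mulrC -ler_pdivlMr// mul1r; exact: hdbarL.
have uE : 1 + u <= E1.
  apply: le_trans E11; rewrite lerD2l /u mulrC ler_wpM2r//.
  by rewrite lerDl ltW.
(* Since [pi <= 4], the factor on the left of [hp] is at least [1 - u / 2], and $(1+u)(1-u/2)\ge1$
   on $[0,1]$. *)
have p1 : p <= E1 * Z.
  have h1 : p * (1 - u / 2) <= Z.
    apply: le_trans hp; rewrite ler_wpM2l//.
    have : u * (pi / 8) <= u * (1 / 2) by rewrite ler_wpM2l//; lra.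
    lra.
  have h2 : 1 <= (1 + u) * (1 - u / 2).
    have : 0 <= u * (1 - u) by rewrite mulr_ge0//; lra.
    lra.
  have u2 : 0 <= 1 - u / 2 by lra.
  have Z0 : 0 <= Z by apply: le_trans h1; rewrite mulr_ge0.
  apply: (@le_trans _ _ ((1 + u) * Z)); last by rewrite ler_wpM2r.
  apply: (@le_trans _ _ ((1 + u) * (p * (1 - u / 2)))); last first.
    by rewrite ler_wpM2l//; lra.
  by rewrite mulrCA ler_peMr.
apply: (le_trans p1).
have c2E : c2 sigma gbar cinf R1 L m dbar =
  E1 * (C1 * G / Num.sqrt dbar + Num.sqrt Lam) / (r * sigma) +
  Num.sqrt Lam * (2 * zeta sigma gbar L * E3 / sigma ^+ 3).
  by rewrite /c2 -/C1 -/G -/Lam -/E1 -/E3 -/r; congr (_ + _); ring.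
have h1 : E1 * Z <= cinf * (E1 * (C1 / Num.sqrt dbar + pi / 2 * Num.sqrt Lam) / (r * sigma)).
  have -> : cinf * (E1 * (C1 / Num.sqrt dbar + pi / 2 * Num.sqrt Lam) / (r * sigma)) =
    E1 * ((cinf * C1 / Num.sqrt dbar + cinf * (pi / 2 * Num.sqrt Lam)) / (r * sigma)).
    by field; rewrite !gt_eqF.
  rewrite ler_pM2l// /Z ler_pM2r ?invr_gt0//; apply: lerD.
    by rewrite ler_pM2r ?invr_gt0.
  by rewrite ler_wpM2l// ler_wpM2l// divr_ge0// pi_ge0.
apply: (le_trans h1); rewrite ler_wpM2l// c2E.
have h2 := ler_wpM2l (ltW sL0) zetaE.
have h3 : C1 / Num.sqrt dbar <= C1 * G / Num.sqrt dbar.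
  by rewrite ler_pM2r ?invr_gt0// ler_peMr.
have h4 : pi / 2 * Num.sqrt Lam <= (5 / 4 + 2 * S) * Num.sqrt Lam by rewrite ler_pM2r.
apply: (@le_trans _ _ (E1 * (C1 * G / Num.sqrt dbar + (5 / 4 + 2 * S) * Num.sqrt Lam) / (r * sigma))).
  by rewrite ler_pM2r ?invr_gt0// ler_pM2l// lerD.
(* Splitting [5 / 4 + 2 * S] as [1 + (2 * S + 1 / 4)]: the [1] is the square-root term of [c2], and
   the rest is absorbed by its [zeta] term. *)
have -> : E1 * (C1 * G / Num.sqrt dbar + (5 / 4 + 2 * S) * Num.sqrt Lam) / (r * sigma) =
  E1 * (C1 * G / Num.sqrt dbar + Num.sqrt Lam) / (r * sigma) +
  Num.sqrt Lam * ((2 * S + 1 / 4) * E1 / (r * sigma)).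
  by field; rewrite !gt_eqF.
by rewrite lerD2l.
Qed.
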